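(* Let $f:\mathbb{R}^n\to\mathbb{R}^n$ be a locally Lipschitz vector field and let $V,\theta\in C^1(\mathbb{R}^n;\mathbb{R})$ be functions that satisfy $$\nabla V(x)f(x)\le 0\ \text{ for all } x\in\mathbb{R}^n,$$ $$\nabla\theta(x)f(x)\le 0\ \text{ for all } x\in\mathbb{R}^n \text{ with } \nabla V(x)f(x)=0.$$ Suppose that for every $z\in\mathbb{R}^n$ and for every $y\in\{x\in\mathbb{R}^n: V(x)\le V(z)\}$ the set $\{x\in\mathbb{R}^n: V(x)\le V(z),\ \theta(x)\le\theta(y)\}$ is compact. Assume that for every $z\in\mathbb{R}^n$ there exists $y_z\in\{x\in\mathbb{R}^n:V(x)\le V(z)\}$ with $\theta(y_z)\ge\theta(z)$ such that $$\{x\in\mathbb{R}^n: V(x)\le V(z)\}\subseteq\{x\in\mathbb{R}^n:\theta(x)\le\theta(y_z)\}\cup\{x\in\mathbb{R}^n:\nabla\theta(x)f(x)\le 0\}.$$ Furthermore, suppose that $V(x)\ge 0$ for all $x\in\mathbb{R}^n$ and that $$S:=\{x\in\mathbb{R}^n:\nabla V(x)f(x)=0\}=\{x\in\mathbb{R}^n:V(x)=0\}.$$ Finally, suppose that for every compact set $K\subseteq\mathbb{R}^n$ with $K\cap S\ne\emptyset$ there exist a function $g\in K_\infty\cap C^1((0,+\infty);\mathbb{R}_+)$ and a constant $\delta>0$ such that $$\nabla\theta(x)f(x)\le\frac{dg}{ds}(V(x))\,|\nabla V(x)f(x)|\quad\text{for all } x\in K \text{ with } 0<V(x)\le\delta \text{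 and } |\nabla V(x)f(x)|\le\delta.$$ Then: - For every $x_0\in\mathbb{R}^n$ the unique solution $x(t)$ of $\dot x=f(x)$ with $x(0)=x_0$ is defined for all $t\ge0$ and is bounded. - The set $S$ is positively invariant for the dynamical system $\dot x=f(x)$. - If $\omega(x_0)$ denotes the positive limit set of $\{x(t):t\ge0\}$, then for every $x_0\in\mathbb{R}^n$, $\omega(x_0)$ is a non-empty, compact, connected, invariant set which satisfies $\omega(x_0)\subseteq\{x\in\mathbb{R}^n:V(x)=\nabla\theta(x)f(x)=0\}$. - Every equilibrium point $x^*\in S$ of $\dot x=f(x)$ for which there is a constant $\tilde\delta>0$ such that $\theta(x^* )<\theta(x)$ for all $x\in S\setminus\{x^*\}$ with $|x-x^*|<\tilde\delta$ and $\{x\in S:\nabla\theta(x)f(x)=0,\ |x-x^*|<\tilde\delta\}=\{x^*\}$, is a locally asymptotically stable equilibrium point of $\dot x=f(x)$.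
   Context: Gradients are row vectors, so $\nabla V(x)f(x)$ is a scalar. $|\cdot|$ is the Euclidean norm. $\mathbb{R}_+=[0,+\infty)$. $K_\infty$ is the class of continuous, (strictly) increasing, unbounded functions $a:\mathbb{R}_+\to\mathbb{R}_+$ with $a(0)=0$; $g\in K_\infty\cap C^1((0,+\infty);\mathbb{R}_+)$ means $g\in K_\infty$ and $g$ is continuously differentiable on $(0,+\infty)$. The positive limit set $\omega(x_0)$ is the set of all $p\in\mathbb{R}^n$ for which there is a sequence $t_i\to+\infty$ with $x(t_i)\to p$. A set is invariant if the solution of $\dot x=f(x)$ starting at any of its points exists for all $t\in\mathbb{R}$ and stays in the set; positively invariant if solutions starting in it stay in it for all $t\ge0$. *)

(* Defs.v *)
From mathcomp Require Import all_boot all_order all_algebra.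
From mathcomp Require Import all_classical all_reals all_analysis.

Set Implicit Arguments.
Unset Strict Implicit.
Unset Printing Implicit Defensive.

Import Order.TTheory GRing.Theory Num.Theory.
Import numFieldNormedType.Exports.

Local Open Scope classical_set_scope.
Local Open Scope ring_scope.

(* The library norm `|x| on 'rV[R]_n is the sup norm. The Euclidean norm is
   defined separately; both induce the same topology, bounded sets and locally
   Lipschitz functions, so the library notions are used for those. *)
Definition enorm (R : realType) (n : nat) (x : 'rV[R]_n) : R :=
  Num.sqrt (\sum_(i < n) x 0 i ^+ 2).

Definition grad (R : realType) (n : nat) (V : 'rV[R]_n -> R) (x : 'rV[R]_n) :
    'rV[R]_n :=
  \row_(i < n) 'D_(delta_mx 0 i) V x.

(* The scalar $\nabla V(x) f(x)$. *)
Definition lie (R : realType) (n : nat) (f : 'rV[R]_n -> 'rV[R]_n)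
    (V : 'rV[R]_n -> R) (x : 'rV[R]_n) : R :=
  \sum_(i < n) grad V x 0 i * f x 0 i.

Definition C1 (R : realType) (n : nat) (V : 'rV[R]_n -> R) : Prop :=
  (forall x, differentiable V x) /\ continuous (grad V).

Definition locally_lipschitz (R : realType) (n : nat)
    (f : 'rV[R]_n -> 'rV[R]_n) : Prop :=
  forall x : 'rV[R]_n, exists2 U : set 'rV[R]_n, nbhs x U &
    [lipschitz f y | y in U].

(* The class $K_\infty \cap C^1((0,+\infty);\mathbb{R}_+)$. A function on
   $\mathbb{R}_+$ is represented by a total one whose values at negative
   arguments are irrelevant; nonnegativity on $\mathbb{R}_+$ follows from
   g 0 = 0 and monotonicity. *)
Definition class_Kinfty (R : realType) (g : R -> R) : Prop :=
  [/\ {within `[0, +oo[%classic, continuous g},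
      (forall s t : R, 0 <= s -> s < t -> g s < g t),
      (forall M : R, exists2 s : R, 0 <= s & M < g s) &
      g 0 = 0].

Definition C1_pos (R : realType) (g : R -> R) : Prop :=
  forall s : R, 0 < s -> derivable g s 1 /\ {for s, continuous (derive1 g)}.

(* x solves $\dot x = f(x)$, x(0) = x0, on the time interval I. The difference
   quotient ranges over increments staying in I, so the derivative is
   one-sided at the endpoints of I that belong to I. *)
Definition is_solution (R : realType) (n : nat) (f : 'rV[R]_n -> 'rV[R]_n)
    (I : set R) (x0 : 'rV[R]_n) (x : R -> 'rV[R]_n) : Prop :=
  x 0 = x0 /\
  forall t : R, I t ->
    h^-1 *: (x (t + h) - x t) @[h --> within [set h | I (t + h)] 0^']
      --> f (x t).

(* Uniqueness is also required among solutions that are only defined on a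
   smaller interval J. *)
Definition is_unique_solution (R : realType) (n : nat)
    (f : 'rV[R]_n -> 'rV[R]_n) (I : set R) (x0 : 'rV[R]_n)
    (x : R -> 'rV[R]_n) : Prop :=
  is_solution f I x0 x /\
  forall (J : set R) (y : R -> 'rV[R]_n),
    is_interval J -> J 0 -> J `<=` I -> is_solution f J x0 y ->
    forall t : R, J t -> y t = x t.

Definition invariant_set (R : realType) (n : nat) (f : 'rV[R]_n -> 'rV[R]_n)
    (A : set 'rV[R]_n) : Prop :=
  forall p : 'rV[R]_n, A p ->
    exists2 x : R -> 'rV[R]_n, is_unique_solution f setT p x &
               forall t : R, A (x t).

Definition positively_invariant (R : realType) (n : nat)
    (f : 'rV[R]_n -> 'rV[R]_n) (A : set 'rV[R]_n) : Prop :=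
  forall p : 'rV[R]_n, A p ->
    exists2 x : R -> 'rV[R]_n, is_unique_solution f `[0, +oo[%classic p x &
               forall t : R, 0 <= t -> A (x t).

Definition omega_limit (R : realType) (n : nat) (x : R -> 'rV[R]_n) :
    set 'rV[R]_n :=
  [set p | exists2 t : nat -> R, t @ \oo --> +oo & x (t i) @[i --> \oo] --> p].

Definition equilibrium (R : realType) (n : nat) (f : 'rV[R]_n -> 'rV[R]_n)
    (xs : 'rV[R]_n) : Prop := f xs = 0.

Definition lyapunov_stable (R : realType) (n : nat) (f : 'rV[R]_n -> 'rV[R]_n)
    (xs : 'rV[R]_n) : Prop :=
  forall eps : R, 0 < eps -> exists2 del : R, 0 < del &
    forall x0 : 'rV[R]_n, enorm (x0 - xs) < del ->
      exists2 x : R -> 'rV[R]_n, is_unique_solution f `[0, +oo[%classic x0 x &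
                 forall t : R, 0 <= t -> enorm (x t - xs) < eps.

Definition locally_attractive (R : realType) (n : nat)
    (f : 'rV[R]_n -> 'rV[R]_n) (xs : 'rV[R]_n) : Prop :=
  exists2 del : R, 0 < del &
    forall x0 : 'rV[R]_n, enorm (x0 - xs) < del ->
      exists2 x : R -> 'rV[R]_n, is_unique_solution f `[0, +oo[%classic x0 x &
                 x t @[t --> +oo] --> xs.

Definition locally_asymptotically_stable (R : realType) (n : nat)
    (f : 'rV[R]_n -> 'rV[R]_n) (xs : 'rV[R]_n) : Prop :=
  [/\ equilibrium f xs, lyapunov_stable f xs & locally_attractive f xs].

(* Main.v *)
(** LaSalle-type argument. The sublevel conditions confine each trajectory to a
    compact set, so the solution is global; truncating [f] outside a box turns
    [f] into a globally Lipschitz field, whose flow exists for all times and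
    depends continuously on the initial point, which makes limit sets invariant.
    Since [V] decreases along trajectories, it is constant on a limit set, hence
    [V = 0] there. By the growth condition [theta + g (V _)] is nonincreasing
    along a trajectory near [V = 0], and [g (V _)] tends to [0]: so [theta] is
    constant on the limit set too. The same function [theta + g (V _)] serves
    as a Lyapunov function near an isolated strict local minimum of [theta] on
    [S]: there a small sphere cannot be reached, because on it [V] small forces
    [theta] to exceed its value at the centre. *)

Require Import Defs.
From mathcomp Require Import all_boot all_order all_algebra.
From mathcomp Require Import all_classical all_reals all_analysis.
From mathcomp Require Import ring lra.

Set Implicit Arguments.
Unset Strict Implicit.

Import Order.TTheory GRing.Theory Num.Theory.
Import numFieldNormedType.Exports.

Local Open Scope classical_set_scope.
Local Open Scope ring_scope.

(** * Curves in row vectors and their derivatives *)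

(** The obstacle is that [theta] need not decrease along a trajectory, and that [g] is
    differentiable only on the open half-line, so [theta + g (V _)] cannot be differentiated where
    [V] vanishes. What survives at all times is [theta (phi b) <= theta (phi a) + g (V (phi a))] for
    [a <= b] late enough; at a limit point the [g] term is [0], and exchanging the two limit points
    gives equality. The covering hypothesis serves confinement: inside a sublevel set of [V],
    [theta] cannot grow once it exceeds its value at the chosen point. Curves are built on the whole
    time line at once, because invariance of limit sets also concerns negative times, where
    trajectories of [f] carry no a priori bound. *)

Lemma rV_norm_leP (R : realType) n (x : 'rV[R]_n) (e : R) : 0 <= e ->
  (`|x| <= e) <-> (forall i, `|x 0 i| <= e).
Proof.
move=> e0; rewrite [`|x|]/Num.Def.normr/= mx_normrE; split=> [/bigmax_leP[_ h] i|h].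
  exact: (h (0, i)).
by apply/bigmax_leP; split=> // -[i j] _ /=; rewrite ord1.
Qed.

Lemma coord_norm_le (R : realType) n (x : 'rV[R]_n) i : `|x 0 i| <= `|x|.
Proof. by move: i; apply/rV_norm_leP. Qed.

Lemma is_derive_rVP (R : realType) n (phi : R -> 'rV[R]_n) (t : R) v :
  is_derive t (1 : R) phi v <-> forall i, is_derive t 1 (fun s => phi s 0 i) (v 0 i).
Proof.
split=> [dphi i|dphi].
  have dp : derivable phi t (1 : R) by exact: ex_derive.
  apply: DeriveDef; first by have /derivable_mxP := dp; exact.
  by rewrite -(derive_val (is_derive := dphi)) derive_mx// mxE.
have dp : derivable phi t 1.
  by apply/derivable_mxP => i j; rewrite ord1; exact: ex_derive.
apply: DeriveDef => //; rewrite derive_mx//; apply/rowP => i; rewrite mxE.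
by rewrite (derive_val (is_derive := dphi i)).
Qed.

Lemma is_derive_continuous (R : realType) (V : normedModType R) (u : R -> V) (t :
  R) v :
  is_derive t (1 : R) u v -> {for t, continuous u}.
Proof.
move=> du; apply/differentiable_continuous/derivable1_diffP; exact: ex_derive.
Qed.

Lemma nincr_of_derive (R : realType) (u du : R -> R) (a b : R) : a <= b ->
  (forall s, a < s < b -> is_derive s 1 u (du s)) ->
  (forall s, a < s < b -> du s <= 0) ->
  {within `[a, b], continuous u} -> u b <= u a.
Proof.
move=> ab hd hle cu.
apply: (@ler0_derive1_nincr R u a b) => // s; rewrite in_itv/= => /[dup] sab /hd hs.
  exact: ex_derive.
by rewrite derive1E derive_val hle.
Qed.

Lemma nincr_of_derive_cc (R : realType) (u du : R -> R) (a b : R) : a <= b ->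
  (forall s, a <= s <= b -> is_derive s 1 u (du s)) ->
  (forall s, a <= s <= b -> du s <= 0) -> u b <= u a.
Proof.
move=> ab hd hle; apply: (@nincr_of_derive R u du) => //.
- by move=> s /andP[/ltW ? /ltW ?]; apply: hd; apply/andP.
- by move=> s /andP[/ltW ? /ltW ?]; apply: hle; apply/andP.
apply: derivable_within_continuous => s; rewrite in_itv/= => /hd ?.
exact: ex_derive.
Qed.

Section primitive.
Variable R : realType.
Notation mu := (@lebesgue_measure R).

Lemma continuous_primitive (g : R -> R) : continuous g ->
  exists G : R -> R, G 0 = 0 /\ forall t, is_derive t (1 : R) G (g t).
Proof.
move=> cg.
have intg a b : mu.-integrable `[a, b] (EFin \o g).
  apply: continuous_compact_integrable; first exact: segment_compact.
  exact: continuous_subspaceT.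
pose I (a t : R) : R := (\int[mu]_(s in `[a, t]) g s)%R.
have dI (a t : R) : a < t -> is_derive t (1 : R) (I a) (g t).
  move=> at1; have [] :=
    @continuous_FTC1_closed R g a t (t + 1) _ (intg _ _) at1 (cg t).
    by rewrite ltrDl.
  by rewrite derive1E => d1 d2; apply: DeriveDef.
have I0 a t : t <= a -> I a t = 0.
  rewrite /I le_eqVlt => /predU1P[->|ta]; first by rewrite set_itv1 Rintegral_set1.
  by rewrite set_itv_ge ?bnd_simp -?ltNge// Rintegral_set0.
have Ichasles a b t : a <= b -> b <= t -> I a t = I a b + I b t.
  move=> ab bt; rewrite /I.
  have := @Rintegral_itvB R g (BLeft a) (BRight t) b (intg a t).
  rewrite !bnd_simp => /(_ ab bt) /eqP; rewrite subr_eq => /eqP ->.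
  rewrite addrC Rintegral_itv_obnd_cbnd//.
  by apply: integrableS (intg b t) => //; apply: subset_itvr; rewrite bnd_simp.
(* Integrals over empty intervals vanish, so one of the two terms is [0] according to the sign of
   [t]: this is the oriented integral from 0 to [t]. *)
exists (fun t => I 0 t - I t 0); split; first by rewrite subrr.
(* A base point below both [t] and 0: near [t] the primitive is [I a s - I a 0], and [t] is to the
   right of [a], as [dI] requires. *)
move=> t; pose a := Num.min t 0 - 1.
have a0 : a <= 0 by rewrite /a lerBlDr ge_min lerDl ler01 orbT.
have at1 : a < t by rewrite /a ltrBlDr gt_min ltrDl ltr01.
have Id : is_derive t (1 : R) (I a - cst (I a 0)) (g t).
  rewrite -[g t]subr0; apply: is_deriveB; exact: dI.
apply: near_eq_is_derive Id.
apply: filterS (lt_nbhsr at1) => s /ltW as1.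
rewrite [LHS](_ : _ = I a s - I a 0)//.
have [s0|s0] := leP 0 s.
  by rewrite (I0 s 0)// subr0 (Ichasles a 0 s)// addrC addKr.
rewrite (I0 0 s) ?ltW// sub0r (Ichasles a s 0 as1 (ltW s0)).
have e (x y : R) : x - (x + y) = - y by ring.
exact: e.
Qed.
End primitive.

Section derive_affine.
Variables (R : realType) (V : normedModType R).

Lemma is_derive_affine (c d t : R) : is_derive t (1 : R) (fun s => c * s + d) c.
Proof.
have -> : (fun s => c * s + d) = (c \*: (@id R)) + cst d by [].
by apply: is_derive_eq; rewrite addr0 [LHS]mulr1.
Qed.

Lemma is_derive_comp_affine (u : R -> V) (c d t : R) v :
  is_derive (c * t + d) (1 : R) u v ->
  is_derive t (1 : R) (fun s => u (c * s + d)) (c *: v).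
Proof.
move=> du; have dff : differentiable u (c * t + d).
  by apply/derivable1_diffP; exact: ex_derive.
have da := is_derive_affine c d t.
have dga : differentiable (fun s : R => c * s + d) t.
  by apply/derivable1_diffP; exact: ex_derive.
have dc : differentiable (u \o (fun s => c * s + d)) t by exact: differentiable_comp.
apply: DeriveDef; first by apply/derivable1_diffP.
rewrite deriveE// diff_comp//=.
have -> : 'd (fun s : R => c * s + d) t (1 : R) = c *: (1 : R).
  by rewrite -deriveE// (derive_val (is_derive := da)) [RHS]mulr1.
by rewrite linearZ/= -deriveE// derive_val.
Qed.

End derive_affine.

Lemma is_derive_expRM (R : realType) (c t : R) :
  is_derive t (1 : R) (fun s => expR (c * s)) (c * expR (c * t)).
Proof.
have := @is_derive_comp_affine R R expR c 0 t (expR (c * t)).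
rewrite addr0; by under eq_fun do rewrite addr0; apply.
Qed.

(* The weight [expR (2 * L * `|t|)] is chosen so that one Picard step halves
   the distance between two curves, on the whole time axis. *)
Lemma exp_growth_bound (R : realType) (G dG : R -> R) (L A : R) :
  0 <= L -> 0 <= A -> G 0 = 0 ->
  (forall s, is_derive s (1 : R) G (dG s)) ->
  (forall s, `|dG s| <= L * A * expR (2 * L * `|s|)) ->
  forall t, `|G t| <= A / 2 * expR (2 * L * `|t|).
Proof.
move=> L0 A0.
suff key : forall H dH : R -> R, H 0 = 0 ->
    (forall s, is_derive s (1 : R) H (dH s)) ->
    (forall s, `|dH s| <= L * A * expR (2 * L * `|s|)) ->
    forall t, 0 <= t -> `|H t| <= A / 2 * expR (2 * L * t).
  move=> G0 hd hle t; have [t0|t0] := leP 0 t; first by rewrite (ger0_norm t0);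
    exact: key.
  have -> : G t = G (-1 * (- t) + 0) by congr G; ring.
  rewrite (ltr0_norm t0).
  apply: (key (fun s => G (-1 * s + 0)) (fun s => -1 *: dG (-1 * s + 0))).
  - by rewrite mulr0 addr0.
  - by move=> s; exact: is_derive_comp_affine.
  - move=> s; apply: le_trans (_ : `|dG (-1 * s + 0)| <= _);
    first by rewrite scaleN1r normrN.
    by apply: le_trans (hle _) _; rewrite addr0 mulN1r normrN.
  - by rewrite oppr_ge0 ltW.
suff kle : forall H dH : R -> R, H 0 = 0 ->
    (forall s, is_derive s (1 : R) H (dH s)) ->
    (forall s, `|dH s| <= L * A * expR (2 * L * `|s|)) ->
    forall t, 0 <= t -> H t <= A / 2 * expR (2 * L * t).
  move=> H dH H0 hd hle t t0; rewrite ler_norml kle// andbT lerNl.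
  apply: (kle (fun s => - H s) (fun s => - dH s)) => //.
  - by rewrite H0 oppr0.
  - by move=> s; rewrite normrN.
move=> H dH H0 hd hle t t0.
have hD s : is_derive s (1 : R) (fun s =>
  expR (2 * L * s)) (2 * L * expR (2 * L * s)).
  exact: is_derive_expRM.
have h : H t - A / 2 * expR (2 * L * t) <= H 0 - A / 2 * expR (2 * L * 0).
  apply: (@nincr_of_derive_cc R (H - (A / 2) \*: (fun s => expR (2 * L * s)))
    (fun s => dH s - (A / 2) *: (2 * L * expR (2 * L * s))) 0 t t0).
  move=> s /andP[s0 _]; rewrite subr_le0 (le_trans (ler_norm _))//
    (le_trans (hle s))//.
  by rewrite ger0_norm// le_eqVlt; apply/orP; left; apply/eqP;
    rewrite /GRing.scale/=; field.
by move: h; rewrite H0 mulr0 expR0 sub0r mulr1; lra.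
Qed.

Lemma exp_growth_bound_rV (R : realType) n (G dG : R -> 'rV[R]_n) (L A : R) :
  0 <= L -> 0 <= A -> G 0 = 0 ->
  (forall s, is_derive s (1 : R) G (dG s)) ->
  (forall s, `|dG s| <= L * A * expR (2 * L * `|s|)) ->
  forall t, `|G t| <= A / 2 * expR (2 * L * `|t|).
Proof.
move=> L0 A0 G0 hd hle t; apply/rV_norm_leP.
  by rewrite mulr_ge0 ?expR_ge0// divr_ge0.
move=> i; apply: (@exp_growth_bound R (fun s => G s 0 i) (fun s => dG s 0 i)) => //.
- by rewrite G0 mxE.
- by move=> s; move: i; apply/is_derive_rVP.
- by move=> s; rewrite (le_trans _ (hle s))// coord_norm_le.
Qed.

Lemma continuous_primitive_rV (R : realType) n (g : R -> 'rV[R]_n) :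
  continuous g ->
  exists G : R -> 'rV[R]_n, G 0 = 0 /\ forall t, is_derive t (1 : R) G (g t).
Proof.
move=> cg.
have /choice[H hH] (i : 'I_n) : exists G : R -> R,
    G 0 = 0 /\ forall t, is_derive t (1 : R) G (g t 0 i).
  apply: (@continuous_primitive R (fun t => g t 0 i)) => t.
  apply: (@continuous_comp _ _ _ g (fun v : 'rV[R]_n => v 0 i)); first exact: cg.
  exact: coord_continuous.
exists (fun t => \row_i H i t); split.
  by apply/rowP => i; rewrite !mxE; have [] := hH i.
move=> t; apply/is_derive_rVP => i; under eq_fun do rewrite mxE.
by have [] := hH i.
Qed.

(** [2 * c / 2 ^+ k] is the sum of all increments allowed from index [k] on. Subtracting and adding
    it to [u k] gives a nondecreasing and a nonincreasing sequence, and the supremum of the former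
    lies below every term of the latter. *)
Lemma geometric_cvg (R : realType) (u : nat -> R) (c : R) :
  (forall k, `|u k.+1 - u k| <= c / 2 ^+ k) ->
  exists l, forall k, `|u k - l| <= 2 * c / 2 ^+ k.
Proof.
move=> hu.
have c0 k : 0 <= c / 2 ^+ k by exact: le_trans (hu k).
have h2 k : c / 2 ^+ k = 2 * (c / 2 ^+ k.+1).
  by rewrite exprS; field; rewrite expf_neq0.
pose v k := u k - 2 * (c / 2 ^+ k); pose w k := u k + 2 * (c / 2 ^+ k).
have vS k : v k <= v k.+1.
  have := hu k; rewrite ler_norml /v !(h2 k) => /andP[]; set e := c / 2 ^+ k.+1; lra.
have wS k : w k.+1 <= w k.
  have := hu k; rewrite ler_norml /w !(h2 k) => /andP[]; set e := c / 2 ^+ k.+1; lra.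
have vm k m : v k <= v (k + m)%N.
  by elim: m => [|m ih]; rewrite ?addn0// addnS (le_trans ih).
have wm k m : w (k + m)%N <= w k.
  by elim: m => [|m ih]; rewrite ?addn0// addnS (le_trans (wS _)).
have vw k m : v k <= w m.
  apply: (le_trans (vm k m)); apply: le_trans (_ : w (k + m)%N <= _).
    by rewrite /v /w; have := c0 (k + m)%N; lra.
  by rewrite addnC wm.
exists (sup (range v)) => k.
have hs : has_sup (range v).
  by split; [exists (v 0); exists 0%N | exists (w 0) => _ [m _ <-]].
have h1 : v k <= sup (range v) by apply: sup_upper_bound => //; exists k.
have h3 : sup (range v) <= w k.
  by apply: ge_sup; [exists (v 0); exists 0%N | move=> _ [m _ <-]].
by rewrite ler_norml; move: h1 h3; rewrite /v /w -mulrA; lra.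
Qed.

(** * Globally Lipschitz vector fields *)

Lemma halving_small (R : realType) (c e : R) : 0 < e -> exists k, c / 2 ^+ k <= e.
Proof.
move=> e0; have [c0|c0] := leP c 0.
  by exists 0%N; rewrite expr0 divr1 (le_trans c0)// ltW.
exists (Num.bound (c / e)).
have h : c / e < 2 ^+ Num.bound (c / e).
  apply: (lt_trans (archi_boundP _)); first by rewrite divr_ge0// ltW.
  by rewrite -natrX ltr_nat ltn_expl.
rewrite ler_pdivrMr ?exprn_gt0// mulrC -ler_pdivrMr//; exact: ltW.
Qed.

Lemma halving_le0 (R : realType) (a c : R) : (forall k, a <= c / 2 ^+ k) -> a <= 0.
Proof.
move=> h; rewrite leNgt; apply/negP => a0.
have [k hk] := @halving_small R c (a / 2) (divr_gt0 a0 (ltr0Sn _ 1)).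
by have := le_trans (h k) hk; lra.
Qed.

Section picard.
Variables (R : realType) (n : nat) (F : 'rV[R]_n -> 'rV[R]_n) (L : R).
Hypothesis L0 : 0 < L.
Hypothesis F_lip : forall x y, `|F x - F y| <= L * `|x - y|.

Lemma lipschitz_cont : continuous F.
Proof.
move=> x; apply/(@cvgrPdist_le R 'rV[R]_n 'rV[R]_n (nbhs x) (nbhs_filter x) F (F x)) => e e0.
apply: filterS (nbhsx_ballx x (e / L) (divr_gt0 e0 L0)) => y.
rewrite -ball_normE /= => /ltW hy; rewrite (le_trans (F_lip _ _))//.
by rewrite mulrC -ler_pdivlMr.
Qed.

(** In the weighted distance with weight [E] the Picard map has ratio 1/2 over the whole real line,
    so no continuation of local solutions is involved. *)
Lemma picard_global (x0 : 'rV[R]_n) : exists x : R -> 'rV[R]_n,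
  x 0 = x0 /\ forall t, is_derive t (1 : R) x (F (x t)).
Proof.
(* A primitive operator on all curves; on discontinuous ones its value is arbitrary, the witness
   being the zero curve. *)
have /choice[P hP] (g : R -> 'rV[R]_n) : exists G : R -> 'rV[R]_n,
    continuous g -> G 0 = 0 /\ forall t, is_derive t (1 : R) G (g t).
  have [cg|ncg] := pselect (continuous g); last by exists (fun=> 0).
  by have [G hG] := @continuous_primitive_rV _ _ g cg; exists G.
pose I (x : R -> 'rV[R]_n) (t : R) : 'rV[R]_n := x0 + P (F \o x) t.
have I0 x : continuous x -> I x 0 = x0.
  move=> cx; have [e _] := hP (F \o x) (fun t => continuous_comp (cx t)
    (@lipschitz_cont (x t))).
  by rewrite /I e addr0.
have dI x t : continuous x -> is_derive t (1 : R) (I x) (F (x t)).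
  move=> cx; have [_ d] := hP (F \o x) (fun t => continuous_comp (cx t)
    (@lipschitz_cont (x t))).
  rewrite -[F (x t)]add0r.
  exact: (@is_deriveD _ _ _ (cst x0) _ _ _ _ _ (is_derive_cst _ _ _) (d t)).
have cI x : continuous x -> continuous (I x).
  by move=> cx t; exact: is_derive_continuous (dI x t cx).
clearbody I.
pose X k := iter k I (cst x0).
have cX k : continuous (X k) by elim: k => [|k ih]; [exact: cst_continuous|exact: cI].
pose E (t : R) := expR (2 * L * `|t|).
have E1 t : 1 <= E t by rewrite /E -expR0 ler_expR !mulr_ge0// ltW.
have E0 t : 0 <= E t by rewrite expR_ge0.
(* With this [A] the first increment, whose derivative is the constant [F x0], meets the bound
   [L * A * E s] because [E] is at least 1. *)
pose A := `|F x0| / L.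
have A0 : 0 <= A by rewrite divr_ge0// ltW.
have bound (x y : R -> 'rV[R]_n) B : continuous x -> continuous y -> 0 <= B ->
    (forall s, `|x s - y s| <= B * E s) ->
    forall t, `|I x t - I y t| <= B / 2 * E t.
  move=> cx cy B0 hxy t.
  have dxy s : is_derive s (1 : R) (fun t => I x t - I y t) (F (x s) - F (y s)).
    exact: (@is_deriveB _ _ _ _ _ _ _ _ _ (dI x s cx) (dI y s cy)).
  apply: (@exp_growth_bound_rV _ _ _ _ L B (ltW L0) B0 _ dxy).
  - by rewrite !I0// subrr.
  - move=> s; rewrite (le_trans (F_lip _ _))// -mulrA ler_wpM2l//; exact: ltW.
have hX k t : `|X k.+1 t - X k t| <= A / 2 ^+ k.+1 * E t.
  elim: k t => [|k ih] t.
    have dx s : is_derive s (1 : R) (fun t => X 1%N t - x0) (F x0 - 0).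
      exact: (@is_deriveB _ _ _ _ (cst x0) _ _ _ _ (dI (cst x0) s (cX 0%N)) (is_derive_cst _ _ _)).
    apply: (@exp_growth_bound_rV _ _ _ _ L A (ltW L0) A0 _ dx).
    - by rewrite /X /= I0 ?subrr//; exact: (cX 0%N).
    - by move=> s; rewrite subr0 /A [L * _]mulrC divfK ?gt_eqF//
      ler_peMr ?normr_ge0 //; exact: (E1 s).
  rewrite exprSr invfM mulrA; apply: (bound (X k.+1) (X k) _ (cX k.+1) (cX k) _ ih).
  by rewrite divr_ge0// exprn_ge0.
have /choice[x hx] (t : R) : exists l : 'rV[R]_n, forall k,
  `|X k t - l| <= A * E t / 2 ^+ k.
  have /choice[l hl] (i : 'I_n) : exists l : R, forall k,
    `|X k t 0 i - l| <= A * E t / 2 ^+ k.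
    have [|l hl] := @geometric_cvg _ (fun k => X k t 0 i) (A * E t / 2).
      move=> k; have := hX k t; rewrite [X in _ <= X](_ : _ = A * E t / 2 / 2 ^+ k).
        apply: le_trans; have := coord_norm_le (X k.+1 t - X k t) i.
        by rewrite !mxE.
      by rewrite exprS; field; rewrite expf_neq0.
    exists l => k; apply: le_trans (hl k) _.
    by rewrite le_eqVlt; apply/orP; left; apply/eqP; field; rewrite expf_neq0.
  exists (\row_i l i) => k; apply/rV_norm_leP;
    first by rewrite divr_ge0 ?exprn_ge0// mulr_ge0.
  by move=> i; rewrite !mxE.
have cE : continuous E.
  move=> t; apply: continuous_comp; last exact: continuous_expR.
  apply: continuousM; first exact: cst_continuous.
  exact: norm_continuous.
have cx : continuous x.
  move=> t; apply/cvgrPdist_le => e e0.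
  (* The rate of convergence carries the factor [E], so it is uniform only locally: [k] is chosen
     for [E t + 1], which bounds [E] near [t]. *)
  have [k hk] := @halving_small R (A * (E t + 1)) (e / 3) (divr_gt0 e0 (ltr0Sn _ 2)).
  have nE : \forall s \near t, E s <= E t + 1.
    have /cvgrPdist_le /(_ 1 ltr01) := cE t; apply: filterS => s.
    by rewrite ler_norml => /andP[]; lra.
  have nX : \forall s \near t, `|X k t - X k s| <= e / 3.
    by have /cvgrPdist_le := cX k t; apply; rewrite divr_gt0.
  near=> s.
  have small u : E u <= E t + 1 -> `|X k u - x u| <= e / 3.
    move=> hu; apply: le_trans (hx u k) (le_trans _ hk).
    by rewrite ler_pM2r ?invr_gt0 ?exprn_gt0// ler_wpM2l.
  have h1 : `|X k t - x t| <= e / 3 by apply: small; rewrite lerDl.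
  have h2 : `|X k s - x s| <= e / 3 by apply: small; near: s.
  have h3 : `|X k t - X k s| <= e / 3 by near: s.
  have -> : x t - x s = (X k t - X k s) + (X k s - x s) - (X k t - x t).
    by apply/rowP => i; rewrite !mxE; ring.
  rewrite (le_trans (ler_normB _ _))// (le_trans (lerD (ler_normD _ _) (lexx _)))//.
  lra.
(* Both [x t] and [I x t] lie within [A * E t / 2 ^+ k.+1] of [X k.+1 t], for every [k]. *)
have xI : I x = x.
  apply/funext => t; apply/eqP; rewrite -subr_eq0 -normr_le0.
  apply: (@halving_le0 _ _ (A * E t)) => k.
  have h1 : `|X k.+1 t - I x t| <= A / 2 ^+ k / 2 * E t.
    apply: bound => //; first by rewrite divr_ge0// exprn_ge0.
    by move=> s; rewrite mulrAC.
  have h2 := hx t k.+1.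
  have -> : I x t - x t = (X k.+1 t - x t) - (X k.+1 t - I x t).
    by apply/rowP => i; rewrite !mxE; ring.
  rewrite (le_trans (ler_normB _ _))// (le_trans (lerD h2 h1))//.
  by rewrite le_eqVlt; apply/orP; left; apply/eqP; rewrite exprS; field;
    rewrite expf_neq0.
by exists x; rewrite -{1}xI I0//; split=> // t; rewrite -{1}xI; exact: dI.
Unshelve. all: by end_near. Qed.

End picard.

(** * Gronwall estimate *)

Lemma norm_le_enorm (R : realType) n (v : 'rV[R]_n) : `|v| <= enorm v.
Proof.
apply/rV_norm_leP; first exact: sqrtr_ge0.
move=> i; rewrite -sqrtr_sqr ler_wsqrtr// (bigD1 i)//= lerDl.
by apply: sumr_ge0 => j _; exact: sqr_ge0.
Qed.

Lemma sqr_enorm (R : realType) n (v : 'rV[R]_n) :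
  enorm v ^+ 2 = \sum_(i < n) v 0 i ^+ 2.
Proof. by rewrite sqr_sqrtr// sumr_ge0// => i _; exact: sqr_ge0. Qed.

Lemma sqr_enorm_continuous (R : realType) n :
  continuous (fun v : 'rV[R]_n => enorm v ^+ 2).
Proof.
have -> : (fun v : 'rV[R]_n => enorm v ^+ 2) =
    \sum_(i < n) (fun v : 'rV[R]_n => v 0 i ^+ 2).
  by apply/funext => v; rewrite sqr_enorm fct_sumE.
elim/big_ind : _ => [|f g cf cg|i _] v; first exact: cst_continuous.
  by apply: continuousD; [exact: cf|exact: cg].
apply: (@continuous_comp _ _ _ (fun v : 'rV[R]_n => v 0 i) (fun x : R => x ^+ 2)).
  exact: coord_continuous.
exact: exprn_continuous.
Qed.

Lemma sqr_enorm_le (R : realType) n (v : 'rV[R]_n) :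
  enorm v ^+ 2 <= n%:R * `|v| ^+ 2.
Proof.
rewrite sqr_enorm; apply: le_trans (_ : \sum_(i < n) `|v| ^+ 2 <= _).
  apply: ler_sum => i _; rewrite -real_normK ?num_real//.
  by rewrite ler_pXn2r ?nnegrE// coord_norm_le.
by rewrite sumr_const card_ord mulr_natl.
Qed.

Lemma near_enorm_lt (R : realType) n (a : 'rV[R]_n) (e : R) : 0 < e ->
  \forall x \near a, enorm (x - a) < e.
Proof.
move=> e0; pose d := e / n.+1%:R.
have d0 : 0 < d by rewrite divr_gt0.
apply: filterS (nbhsx_ballx a d d0) => x; rewrite -ball_normE /= distrC => xd.
suff : enorm (x - a) ^+ 2 < e ^+ 2.
  by rewrite ltr_pXn2r// nnegrE ?sqrtr_ge0// ltW.
apply: (le_lt_trans (sqr_enorm_le _)).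
have h : `|x - a| ^+ 2 <= d ^+ 2 by rewrite ler_pXn2r ?nnegrE// ltW.
apply: (le_lt_trans (ler_wpM2l (ler0n _ _) h)).
rewrite /d expr_div_n mulrCA -ltr_pdivlMl ?exprn_gt0// mulVf ?expf_neq0 ?gt_eqF//.
rewrite ltr_pdivrMr ?exprn_gt0// mul1r -natrX ltr_nat.
by rewrite expnS expn1 (leq_trans (ltnSn n))// leq_pmulr.
Qed.

Lemma is_derive_sqr_enorm (R : realType) n (z : R -> 'rV[R]_n) (s : R) v :
  is_derive s (1 : R) z v ->
  is_derive s (1 : R) (fun t =>
    enorm (z t) ^+ 2) (\sum_(i < n) 2 * (z s 0 i * v 0 i)).
Proof.
move=> dz.
have -> : (fun t => enorm (z t) ^+ 2) = \sum_(i < n) ((fun t => z t 0 i) ^+ 2).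
  by apply/funext => t; rewrite sqr_enorm fct_sumE; apply: eq_bigr => i _.
apply: is_derive_sum => i.
have /is_derive_rVP/(_ i) dzi := dz.
apply: is_derive_eq; rewrite expr1 /GRing.scale/=; ring.
Qed.

(* The sup norm is not differentiable, so the estimate is run on the squared
   Euclidean norm, at the price of the factor n in the exponent. *)
Lemma gronwall (R : realType) n (z dz : R -> 'rV[R]_n) (L T : R) :
  0 <= L -> 0 <= T ->
  (forall s, 0 < s < T -> is_derive s (1 : R) z (dz s)) ->
  (forall s, 0 < s < T -> `|dz s| <= L * `|z s|) ->
  {within `[0, T], continuous z} ->
  enorm (z T) ^+ 2 <= expR (2 * L * n%:R * T) * enorm (z 0) ^+ 2.
Proof.
move=> L0 T0 hd hle cz.
pose c := - (2 * L * n%:R).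
pose u := fun s => expR (c * s) * enorm (z s) ^+ 2.
pose du s := expR (c * s) *: (\sum_(i < n) 2 * (z s 0 i * dz s 0 i)) +
             enorm (z s) ^+ 2 *: (c * expR (c * s)).
have hdu s : 0 < s < T -> is_derive s (1 : R) u (du s).
  move=> sT; exact: (@is_deriveM _ _ (fun s => expR (c * s)) _ _ _ _ _
    (is_derive_expRM c s) (is_derive_sqr_enorm (hd s sT))).
have : u T <= u 0.
  apply: (nincr_of_derive T0 hdu).
  - move=> s sT.
    have -> : du s = expR (c * s) * (\sum_(i < n) 2 * (z s 0 i * dz s 0 i) + c * enorm (z s) ^+ 2).
      by rewrite /du /GRing.scale/=; ring.
    rewrite pmulr_rle0 ?expR_gt0// /c mulNr subr_le0.
    apply: le_trans (_ : \sum_(i < n) 2 * L * enorm (z s) ^+ 2 <= _); last first.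
      by rewrite sumr_const card_ord -[leLHS]mulr_natl [leRHS](_ :
        _ = n%:R * (2 * L * enorm (z s) ^+ 2))//; ring.
    apply: ler_sum => i _; rewrite -mulrA ler_wpM2l//.
    apply: le_trans (ler_norm _) _; rewrite normrM.
    apply: le_trans (_ : `|z s| * (L * `|z s|) <= _).
      by apply: ler_pM => //; [exact:
        coord_norm_le|rewrite (le_trans _ (hle s sT))// coord_norm_le].
    rewrite mulrCA ler_wpM2l// -expr2 ler_pXn2r ?nnegrE ?sqrtr_ge0//.
    exact: norm_le_enorm.
  - move=> t; apply: (@continuousM R (subspace `[0, T]) (fun s =>
    expR (c * s)) (fun s => enorm (z s) ^+ 2)).
      apply: continuous_subspaceT => s; exact:
        (is_derive_continuous (is_derive_expRM c s)).
    apply: (@continuous_comp _ _ _ (z : subspace _ -> _) (fun v => enorm v ^+ 2));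
      first exact: cz.
    exact: sqr_enorm_continuous.
rewrite /u mulr0 expR0 mul1r.
by rewrite /c mulNr expRN ler_pdivrMl ?expR_gt0.
Qed.

(** * Solutions of locally Lipschitz fields *)

Lemma locally_lipschitz_near (R : realType) n (f : 'rV[R]_n -> 'rV[R]_n)
    (a : 'rV[R]_n) :
  locally_lipschitz f -> exists U : set 'rV[R]_n, exists2 K : R, 0 < K &
    nbhs a U /\ forall M x y, K <= M -> U x -> U y -> `|f x - f y| <= M * `|x - y|.
Proof.
move=> fl; have [U Ua /= [M [_ hM]]] := fl a.
exists U, (`|M| + 1); first by rewrite ltr_wpDl.
split=> // K x y MK Ux Uy; apply: (hM K _ (x, y)) => //.
by rewrite (lt_le_trans _ MK)// (le_lt_trans (ler_norm M))// ltrDl.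
Qed.

Lemma locally_lipschitz_continuous (R : realType) n (f : 'rV[R]_n -> 'rV[R]_n) :
  locally_lipschitz f -> continuous f.
Proof.
move=> fl a; have [U [K K0 [Ua hU]]] := locally_lipschitz_near a fl.
apply/(@cvgrPdist_le R 'rV[R]_n 'rV[R]_n (nbhs a) (nbhs_filter a)) => e e0.
apply: filterS (filterI Ua (nbhsx_ballx a (e / K) (divr_gt0 e0 K0))) => y [Uy].
rewrite -ball_normE /= => /ltW hy; apply:
  le_trans (hU K _ _ (lexx _) (nbhs_singleton Ua) Uy) _.
by rewrite mulrC -ler_pdivlMr.
Qed.

Lemma near_norm_lt (R : realType) n (a : 'rV[R]_n) (e : R) : 0 < e ->
  \forall x \near a, `|a - x| < e.
Proof. by move=> e0; apply: filterS (nbhsx_ballx a e e0) => x;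
  rewrite -ball_normE. Qed.

(** Compactness is applied to pairs, in [K * K]. Near a diagonal point the local constant serves;
    near an off-diagonal pair [f x - f y] is bounded while [x - y] stays away from 0, so their
    quotient is bounded. *)
Lemma lipschitz_on_compact (R : realType) n (f : 'rV[R]_n -> 'rV[R]_n) K :
  locally_lipschitz f -> compact K ->
  exists2 L : R, 0 < L & forall x y, K x -> K y -> `|f x - f y| <= L * `|x - y|.
Proof.
move=> fl cK.
pose P (M : R) (p : 'rV[R]_n * 'rV[R]_n) := `|f p.1 - f p.2| <= M * `|p.1 - p.2|.
have cf := locally_lipschitz_continuous fl.
have /compact_near_coveringP/(_ R +oo%R P _) := compact_setX cK cK.
case=> [[a b] _|M0 [_ hM]]; last first.
  exists (`|M0| + 1); first by rewrite ltr_wpDl.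
  move=> x y Kx Ky; apply: (hM _ _ (x, y)) => //.
  by rewrite (le_lt_trans (ler_norm M0))// ltrDl.
have [->|ab] := eqVneq a b.
  have [U [K1 K10 [Ua hU]]] := locally_lipschitz_near b fl.
  exists (U `*` U, [set M | K1 <= M]).
    by split; [exists (U, U)|exact: nbhs_pinfty_ge (num_real _)].
  by move=> [[x y] M] [/= [Ux Uy] KM]; exact: hU.
pose d := `|a - b|; have d0 : 0 < d by rewrite normr_gt0 subr_eq0.
pose C := `|f a - f b| + 2.
have C0 : 0 <= C by rewrite addr_ge0.
have nf c : \forall x \near c, `|f c - f x| <= 1.
  have := cf c.
  by move=> /(@cvgrPdist_le R 'rV[R]_n 'rV[R]_n (nbhs c) (nbhs_filter c)); exact.
pose W c := [set x | `|c - x| < d / 4 /\ `|f c - f x| <= 1].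
have nW c : nbhs c (W c).
  by apply: filterI; [apply: near_norm_lt; rewrite divr_gt0|exact: nf].
exists (W a `*` W b, [set M | C / (d / 2) <= M]).
  by split; [exists (W a, W b)|exact: nbhs_pinfty_ge (num_real _)].
move=> [[x y] M] [/= [[ax fax] [by1 fby]] CM]; rewrite /P/=.
have h1 : d / 2 <= `|x - y|.
  have : d <= `|a - x| + `|x - y| + `|b - y|.
    rewrite /d (_ : a - b = (a - x) + (x - y) - (b - y)).
      by rewrite (le_trans (ler_normB _ _))// lerD2r ler_normD.
    by apply/rowP => i; rewrite !mxE; ring.
  by lra.
have h2 : `|f x - f y| <= C.
  rewrite (_ : f x - f y = (f a - f b) - (f a - f x) + (f b - f y)); last first.
    by apply/rowP => i; rewrite !mxE; ring.
  rewrite /C (le_trans (ler_normD _ _))//.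
  have := ler_normB (f a - f b) (f a - f x); lra.
apply: (le_trans h2); rewrite ler_pdivrMr ?divr_gt0// in CM.
apply: (le_trans CM); rewrite ler_wpM2l//.
have : 0 <= M * (d / 2) by exact: le_trans CM.
by rewrite pmulr_lge0 // divr_gt0.
Qed.

Section solutions.
Variables (R : realType) (n : nat) (f : 'rV[R]_n -> 'rV[R]_n).

Lemma is_derive_solution (I : set R) x0 (x : R -> 'rV[R]_n) : x 0 = x0 ->
  (forall t, I t -> is_derive t (1 : R) x (f (x t))) -> is_solution f I x0 x.
Proof.
move=> x00 hd; split=> // t It; apply: cvg_within_filter.
have dx := hd t It; have : derivable x t (1 : R) by exact: ex_derive.
rewrite -(derive_val (is_derive := dx)) => /cvg_ex[l hl].
have -> : 'D_1 x t = l by exact: cvg_lim hl.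
apply: cvg_trans hl; apply: near_eq_cvg; apply: nearW => h.
by rewrite /= [h%:A]mulr1 [h + t]addrC.
Qed.

Lemma is_solution_sub (I J : set R) x0 x : J `<=` I ->
  is_solution f I x0 x -> is_solution f J x0 x.
Proof.
move=> JI [x00 hx]; split=> // t /JI /hx; apply: cvg_trans; apply: cvg_app.
by apply: within_subset => h /JI.
Qed.

Lemma is_solution_interior (I : set R) x0 x t :
  is_solution f I x0 x -> nbhs t I -> is_derive t (1 : R) x (f (x t)).
Proof.
move=> [_ hx] It; have := hx t (nbhs_singleton It) => hl.
have {}hl : h^-1 *: (x (h *: (1 : R) + t) - x t) @[h --> 0^'] --> f (x t).
  apply: cvg_trans hl => A; rewrite /nbhs/= /within/= => hA.
  have nI : \forall h \near (0 : R)^', I (t + h).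
    apply: nbhs_dnbhs; have : (fun h => t + h) @ (0 : R) --> t + 0.
      by apply: cvgD; [exact: cvg_cst|exact: cvg_id].
    by rewrite addr0; apply.
  apply: filterS2 nI hA => h Ih /(_ Ih); rewrite /preimage/=.
  by rewrite [h *: 1]mulr1 [h + t]addrC.
apply: DeriveDef; first by apply/cvg_ex; exists (f (x t)).
exact: cvg_lim hl.
Qed.

(** At an endpoint of [I] only a one-sided difference quotient converges; this bound still yields
    continuity relative to [I] there. *)
Lemma is_solution_linear_bound (I : set R) x0 x t :
  is_solution f I x0 x -> I t -> exists2 C : R, 0 < C &
  exists2 d : R, 0 < d & forall s, `|s - t| < d -> I s ->
    `|x s - x t| <= C * `|s - t|.
Proof.
move=> [_ hx] It; have := hx t It.
set D := within _ _ => hl.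
have : \forall h \near D, `|f (x t) - h^-1 *: (x (t + h) - x t)| <= 1.
  have /= := (@cvgrPdist_le R 'rV[R]_n R D _ _ _).1 hl 1 ltr01; exact.
rewrite {hl}/D => -[d /= d0 hd].
exists (`|f (x t)| + 1); first by rewrite ltr_wpDl.
exists d => // s sd Is; have [->|st] := eqVneq s t;
  first by rewrite !subrr !normr0 mulr0.
have st0 : s - t != 0 by rewrite subr_eq0.
have := hd (s - t); rewrite /ball_/= sub0r normrN subrKC => /(_ sd st0 Is) h.
have -> : x s - x t = (s - t) *: ((s - t)^-1 *:
  (x s - x t)) by rewrite scalerA divff// scale1r.
rewrite normrZ mulrC ler_wpM2r//.
rewrite -lerBlDl (le_trans _ h)// distrC; exact: lerB_dist.
Qed.

End solutions.

(** The argument [c * s + 0] is the affine form of [is_derive_comp_affine]; [c] is 1 or -1, one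
    value for each direction of time. *)
Lemma is_solution_within_continuous (R : realType) n (f : 'rV[R]_n -> 'rV[R]_n)
    (I A : set R) x0 (x : R -> 'rV[R]_n) (c : R) : `|c| = 1 ->
  (forall s, A s -> I (c * s + 0)) ->
  is_solution f I x0 x -> {within A, continuous (fun s => x (c * s + 0))}.
Proof.
move=> c1 AI sx; apply/subspace_continuousP => s As.
have [C C0 [d d0 hd]] := is_solution_linear_bound sx (AI s As).
apply/(@cvgrPdist_le R 'rV[R]_n R _ _) => e e0.
have m0 : 0 < Num.min d (e / C) by rewrite lt_min d0 divr_gt0.
apply: filterS (nbhsx_ballx s _ m0) => u; rewrite -ball_normE /= lt_min =>
  /andP[h1 h2] Au.
have e1 : `|c * u + 0 - (c * s + 0)| = `|s - u|.
  by rewrite !addr0 -mulrBr normrM c1 mul1r distrC.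
rewrite distrC (le_trans (hd _ _ (AI u Au)))// e1//.
by rewrite mulrC -ler_pdivlMr// ltW.
Qed.

Lemma enorm0 (R : realType) n : enorm (0 : 'rV[R]_n) = 0.
Proof. by rewrite /enorm big1 ?sqrtr0// => i _; rewrite mxE expr0n. Qed.

(* The sign [c] handles forward and backward times at once. *)
Lemma solution_dist (R : realType) n (f : 'rV[R]_n -> 'rV[R]_n) (J : set R)
    x0 y0 (x y : R -> 'rV[R]_n) (c T L : R) :
  `|c| = 1 -> 0 <= T -> 0 <= L -> (forall s, 0 <= s <= T -> J (c * s + 0)) ->
  is_solution f J x0 x -> is_solution f J y0 y ->
  (forall s, 0 <= s <= T -> `|f (x (c * s + 0)) - f (y (c * s + 0))| <=
                            L * `|x (c * s + 0) - y (c * s + 0)|) ->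
  enorm (x (c * T + 0) - y (c * T + 0)) ^+ 2 <=
    expR (2 * L * n%:R * T) * enorm (x0 - y0) ^+ 2.
Proof.
move=> c1 T0 L0 JT sx sy hL.
have cc : c * c = 1 by rewrite -expr2 -real_normK ?num_real// c1 expr1n.
have Jn s : 0 < s < T -> nbhs (c * s + 0) J.
  move=> /andP[s0 sT]; have m0 : 0 < Num.min s (T - s) by rewrite lt_min s0 subr_gt0.
  apply: filterS (nbhsx_ballx (c * s + 0) _ m0) => u; rewrite -ball_normE /= => hu.
  have -> : u = c * (c * u) + 0 by rewrite mulrA cc mul1r addr0.
  have : `|s - c * u| < Num.min s (T - s).
    have -> : s - c * u = c * (c * s + 0 - u) by rewrite addr0 mulrBr mulrA cc mul1r.
    by rewrite normrM c1 mul1r.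
  rewrite lt_min !ltr_norml => /andP[/andP[h1 h2] /andP[h3 h4]].
  by apply: JT; apply/andP; split; lra.
have hd s : 0 < s < T -> is_derive s (1 : R)
    (fun s => x (c * s + 0) - y (c * s + 0))
    (c *: f (x (c * s + 0)) - c *: f (y (c * s + 0))).
  move=> sT; have nJ := Jn s sT.
  exact: (@is_deriveB _ _ _ _ _ _ _ _ _
    (is_derive_comp_affine (is_solution_interior sx nJ))
    (is_derive_comp_affine (is_solution_interior sy nJ))).
have := gronwall L0 T0 hd.
have -> : x (c * 0 + 0) - y (c * 0 + 0) = x0 - y0.
  by rewrite mulr0 addr0 sx.1 sy.1.
apply.
  move=> s /andP[/ltW s0 /ltW sT]; rewrite -scalerBr normrZ c1 mul1r.
  by apply: hL; rewrite s0.
have AJ s : `[0, T]%classic s -> J (c * s + 0) by rewrite /= in_itv/=; exact: JT.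
move=> s; apply: (@continuousB _ _ _ (fun s : subspace _ => x (c * s + 0)) (fun s :
  subspace _ => y (c * s + 0))).
  exact: (is_solution_within_continuous c1 AJ sx).
exact: (is_solution_within_continuous c1 AJ sy).
Qed.

(** Over a compact time segment both arcs lie in one compact set, where a single Lipschitz constant
    holds; the distance estimate with equal initial values then forces them to coincide. *)
Lemma solution_unique (R : realType) n (f : 'rV[R]_n -> 'rV[R]_n) (J : set R)
    x0 (x y : R -> 'rV[R]_n) :
  locally_lipschitz f -> is_interval J -> J 0 ->
  is_solution f J x0 x -> is_solution f J x0 y -> forall t, J t -> y t = x t.
Proof.
move=> fl iJ J0 sx sy.
suff key (c T : R) : `|c| = 1 -> 0 <= T -> J (c * T + 0) ->
  y (c * T + 0) = x (c * T + 0).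
  move=> t Jt; have [t0|t0] := leP 0 t.
    by have := key 1 t (normr1 _) t0; rewrite mul1r addr0; exact.
  have := key (-1) (- t); rewrite normrN1 mulN1r opprK addr0; apply => //.
  by rewrite oppr_ge0 ltW.
move=> c1 T0 JT.
have cB : -1 <= c <= 1 by rewrite -ler_norml c1.
have Js s : 0 <= s <= T -> J (c * s + 0).
  move=> /andP[s0 sT]; rewrite addr0; have [c0|c0] := leP 0 c.
    apply: (iJ 0 (c * T + 0)) => //; rewrite mulr_ge0//= addr0.
    exact: ler_wpM2l.
  apply: (iJ (c * T + 0) 0) => //; rewrite addr0.
  by rewrite ler_wnM2l ?(ltW c0)//= nmulr_rle0.
pose K := ((fun s => x (c * s + 0)) @` `[0, T]) `|` ((fun s =>
  y (c * s + 0)) @` `[0, T]).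
have AJ s : `[0, T]%classic s -> J (c * s + 0) by rewrite /= in_itv/=; exact: Js.
have cK : compact K.
  by apply: compactU; (apply: continuous_compact; last exact: segment_compact);
    [exact: (is_solution_within_continuous c1 AJ sx)|
     exact: (is_solution_within_continuous c1 AJ sy)].
have [L L0 hL] := lipschitz_on_compact fl cK.
have := solution_dist c1 T0 (ltW L0) Js sx sy.
have Kx s : 0 <= s <= T -> K (x (c * s + 0)).
  by move=> sT; left; exists s => //=; rewrite in_itv.
have Ky s : 0 <= s <= T -> K (y (c * s + 0)).
  by move=> sT; right; exists s => //=; rewrite in_itv.
move=> /(_ (fun s sT => hL _ _ (Kx s sT) (Ky s sT))).
rewrite subrr enorm0 expr0n mulr0 => h.
apply/esym/eqP; rewrite -subr_eq0 -normr_le0 (le_trans (norm_le_enorm _))//.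
by rewrite -(ler_pXn2r (n := 2))// ?nnegrE ?sqrtr_ge0// expr0n.
Qed.

Lemma solution_is_unique (R : realType) n (f : 'rV[R]_n -> 'rV[R]_n) (I : set R)
    x0 (x : R -> 'rV[R]_n) :
  locally_lipschitz f -> is_solution f I x0 x -> is_unique_solution f I x0 x.
Proof.
move=> fl sx; split=> // J y iJ J0 JI sy t Jt.
exact: (solution_unique fl iJ J0 (is_solution_sub JI sx) sy).
Qed.

(** * Truncation of a field outside a box *)

Section clamp.
Variables (R : realType) (n : nat).

Definition clamp (r : R) (v : 'rV[R]_n) : 'rV[R]_n :=
  \row_i Num.max (- r) (Num.min r (v 0 i)).

Lemma clamp_norm r v : 0 <= r -> `|clamp r v| <= r.
Proof.
move=> r0; apply/rV_norm_leP => // i; rewrite mxE ler_norml le_max lexx /=.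
by rewrite ge_max ge_min lexx /= andbT; lra.
Qed.

Lemma clamp_id r v : `|v| <= r -> clamp r v = v.
Proof.
move=> vr; apply/rowP => i; rewrite mxE.
have /andP[h1 h2] :
  - r <= v 0 i <= r by rewrite -ler_norml (le_trans (coord_norm_le v i)).
by rewrite min_r// max_r.
Qed.

Lemma clamp_lip r u v : `|clamp r u - clamp r v| <= `|u - v|.
Proof.
apply/rV_norm_leP => // i; apply: le_trans (coord_norm_le (u - v) i).
rewrite !mxE; move: (u 0 i) (v 0 i) => a b {u v}.
wlog ab : a b / a <= b => [h|].
  by have [/h //|/ltW/h] := leP a b; rewrite distrC [X in _ <= X]distrC.
have le0 : Num.max (- r) (Num.min r a) <= Num.max (- r) (Num.min r b).
  have h : Num.min r a <= Num.min r b by rewrite le_min !ge_min lexx ab orbT.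
  by rewrite ge_max !le_max lexx h orbT.
rewrite [X in X <= _]distrC [X in _ <= X]distrC !ger0_norm ?subr_ge0//.
by clear le0; case: (leP r a) => ?; case: (leP r b) => ?; case: (leP (- r) r) => ?;
  case: (leP (- r) a) => ?; case: (leP (- r) b) => ?; lra.
Qed.

Lemma box_compact (r : R) : compact [set v : 'rV[R]_n | `|v| <= r].
Proof.
have [r0|r0] := leP 0 r; last first.
  suff -> : [set v : 'rV[R]_n | `|v| <= r] = set0 by exact: compact0.
  by apply/seteqP; split => v //=; rewrite leNgt (lt_le_trans r0).
have -> : [set v : 'rV[R]_n | `|v| <= r] =
    [set v : 'rV[R]_n | forall i, `[- r, r]%classic (v ord0 i)].
  apply/seteqP; split => v /=.
    by move=> /(rV_norm_leP _ r0) h i; rewrite in_itv/= -ler_norml.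
  by move=> h; apply/rV_norm_leP => // i; have := h i; rewrite in_itv/= -ler_norml.
by apply: (@rV_compact _ _ (fun=> `[- r, r]%classic)) => _; exact: segment_compact.
Qed.

(* Composing with the coordinatewise clamp, which is 1-Lipschitz for the sup
   norm, makes the field globally Lipschitz without changing it on a box. *)
Lemma lipschitz_truncation (f : 'rV[R]_n -> 'rV[R]_n) (r : R) :
  0 <= r -> locally_lipschitz f ->
  exists F : 'rV[R]_n -> 'rV[R]_n, exists2 L : R, 0 < L &
    (forall x y, `|F x - F y| <= L * `|x - y|) /\
    (forall x, `|x| <= r -> F x = f x).
Proof.
move=> r0 fl; have [L L0 hL] := lipschitz_on_compact fl (@box_compact r).
exists (f \o clamp r), L => //; split=> [x y|x xr] /=; last by rewrite clamp_id.
apply: (le_trans (hL _ _ (clamp_norm _ r0) (clamp_norm _ r0))).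
by rewrite ler_wpM2l ?(ltW L0)// clamp_lip.
Qed.

End clamp.

(** * Limit sets *)

Section omega_limit.
Variables (R : realType) (n : nat).
Implicit Types (x y : R -> 'rV[R]_n).

(** The filter form gives closedness, and nonemptiness by compactness, directly. Conversely, a
    sequence is recovered by choosing a time beyond [i] with error below [1 / (i + 1)]. *)
Lemma omega_limitE x : omega_limit x = cluster (x @ +oo).
Proof.
apply/seteqP; split => [p [t toy xp] A B xA pB|p xp].
  have nA : \forall i \near \oo, A (x (t i)) := toy _ xA.
  have nB : \forall i \near \oo, B (x (t i)) := xp _ pB.
  by have [i [Ai Bi]] := filter_ex (filterI nA nB); exists (x (t i)).
have /choice[t ht] (i : nat) : exists s : R, i%:R <= s /\ `|p - x s| < i.+1%:R^-1.
  have nA : (x @ +oo) (x @` [set s | i%:R <= s]).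
    by apply: filterS (nbhs_pinfty_ge (num_real i%:R)) => s si; exists s.
  have nB : nbhs p [set v | `|p - v| < i.+1%:R^-1] by apply: near_norm_lt;
    rewrite invr_gt0.
  by have [_ [[s si <-] xs]] := xp _ _ nA nB; exists s.
exists t.
  apply/cvgryPge => M; apply: filterS (nbhs_infty_ger M) => i Mi.
  exact: le_trans (ht i).1.
apply/cvgrPdist_lt => e e0; apply: filterS (near_infty_natSinv_lt (PosNum e0)) =>
  i ie.
exact: lt_trans (ht i).2 ie.
Qed.

Lemma omega_limit_eq x y : (forall t, 0 <= t -> x t = y t) ->
  omega_limit x = omega_limit y.
Proof.
move=> xy; rewrite !omega_limitE; congr cluster.
have e (A : set 'rV[R]_n) : \forall t \near +oo, A (x t) = A (y t).
  by apply: filterS (nbhs_pinfty_ge (num_real 0)) => t /xy ->.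
apply/seteqP; split=> A /= hA; apply: filterS2 (e A) hA => t; rewrite /preimage/=.
  by move=> ->.
by move=> <-.
Qed.

Lemma omega_limit_closed x : closed (omega_limit x).
Proof.
by rewrite omega_limitE clusterE; apply: closed_bigI => A _; exact: closed_closure.
Qed.

Variables (K : set 'rV[R]_n) (x : R -> 'rV[R]_n).
Hypothesis cK : compact K.
Hypothesis xK : \forall t \near +oo, K (x t).

Lemma omega_limit_sub : omega_limit x `<=` K.
Proof.
move=> p; rewrite omega_limitE clusterE => /(_ K xK).
by have /closure_id <- := compact_closed (@norm_hausdorff _ _) cK.
Qed.

Lemma omega_limit_compact : compact (omega_limit x).
Proof. exact: subclosed_compact (@omega_limit_closed x) cK omega_limit_sub. Qed.

Lemma omega_limit_nonempty : omega_limit x !=set0.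
Proof. by have [p [_ xp]] := @cK (x @ +oo) _ xK; exists p; rewrite omega_limitE. Qed.

(** If the curve left [U] at arbitrarily late times, those times would generate a proper filter; its
    image clusters in [K] at a limit point outside the open set [U]. *)
Lemma omega_limit_attracts (U : set 'rV[R]_n) : open U -> omega_limit x `<=` U ->
  \forall t \near +oo, U (x t).
Proof.
move=> oU wU; apply: contrapT => nU.
pose F := within [set t | ~ U (x t)] (+oo : set_system R).
have FF : ProperFilter F.
  apply: Build_ProperFilter_ex => A FA; apply: contrapT => A0; apply: nU.
  have {}FA : \forall t \near +oo, ~ U (x t) -> A t := FA.
  by apply: filterS FA => t hA; apply: contrapT => nUt; apply: A0; exists t;
    exact: hA.
have subF A : (\forall t \near +oo, A (x t)) -> (x @ F) A.
  by move=> hA; have : \forall t \near +oo, ~ U (x t) -> A (x t) by apply: filterS hA.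
have [p [Kp xp]] := @cK (x @ F) _ (subF _ xK).
have : omega_limit x p.
  by rewrite omega_limitE => A B xA; apply: xp; exact: subF.
move=> /wU Up.
have nUF : (x @ F) (~` U).
  by have : \forall t \near +oo, ~ U (x t) -> (~` U) (x t) by apply: nearW.
have [v [nUv Uv]] := xp _ U nUF (open_nbhs_nbhs (conj oU Up)).
exact: nUv.
Qed.

(** A proper nonempty clopen part [B] and its complement [B'] are disjoint closed sets, separated by
    open [U] and [V]. A tail of the curve lies in their union and visits both, although the image of
    the tail is connected. *)
Lemma omega_limit_connected : continuous x -> connected (omega_limit x).
Proof.
move=> cx B [p Bp] [C oC BC] [D cD BD]; apply: contrapT => nB.
have [q wq nBq] : exists2 q, omega_limit x q & ~ B q.
  apply: contrapT => h; apply: nB; apply/seteqP; split; first by rewrite BC => v [].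
  by move=> v wv; apply: contrapT => nv; apply: h; exists v.
have clB : closed B by rewrite BD; apply: closedI => //; exact: omega_limit_closed.
pose B' := omega_limit x `&` ~` C.
have clB' : closed B'.
  by apply: closedI; [exact: omega_limit_closed|exact: open_closedC].
have BB' : B `&` B' = set0.
  by rewrite BC; apply/seteqP; split => v // [[_ Cv] [_ /(_ Cv)]].
have B'q : B' q by split=> // Cq; apply: nBq; rewrite BC.
have [U [V [oU oV BU B'V UV]]] :=
  (@normal_openP R _).1 pseudometric_normal _ _ clB clB' BB'.
have : \forall t \near +oo, (U `|` V) (x t).
  apply: omega_limit_attracts; first exact: openU.
  move=> v wv; have [Cv|nCv] := pselect (C v); first by left; apply: BU; rewrite BC.
  by right; apply: B'V.
move=> [T [_ hT]].
pose I := x @` `]T, +oo[.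
have cI : connected I.
  apply: connected_continuous_connected; last exact: continuous_subspaceT.
  by apply/connected_intervalP; exact: interval_is_interval.
have IUV v : I v -> (U `|` V) v.
  by move=> [t /=]; rewrite in_itv/= andbT => Tt <-; exact: hT.
have hit W v : open W -> omega_limit x v -> W v -> exists2 u, I u & W u.
  move=> oW; rewrite omega_limitE => xv Wv.
  have nI : (x @ +oo) I.
    exists T; split; first exact: num_real.
    by move=> t Tt; exists t => //=; rewrite in_itv/= andbT.
  by have [u [Iu Wu]] := xv I W nI (open_nbhs_nbhs (conj oW Wv)); exists u.
have disj u : U u -> V u -> False.
  by move=> Uu Vu; have : (U `&` V) u by []; rewrite UV.
have wp : omega_limit x p by move: Bp; rewrite BC => -[].
have [u Iu Uu] := hit U p oU wp (BU _ Bp).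
have IU : I `&` U = I.
  apply: cI; first by exists u.
    by exists U.
  exists (~` V); first exact: open_closedC.
  apply/seteqP; split => v [Iv hv]; split=> //; first by move=> Vv; exact: disj hv Vv.
  by have [] := IUV _ Iv.
have [v Iv Vv] := hit V q oV wq (B'V _ B'q).
by move: Iv; rewrite -IU => -[_ Uv]; exact: disj Uv Vv.
Qed.

End omega_limit.

(** * Scalar functions along trajectories *)

Lemma is_derive_lie (R : realType) n (f : 'rV[R]_n -> 'rV[R]_n) (V : 'rV[R]_n -> R)
    (phi : R -> 'rV[R]_n) (t : R) :
  C1 V -> is_derive t (1 : R) phi (f (phi t)) ->
  is_derive t (1 : R) (fun s => V (phi s)) (lie f V (phi t)).
Proof.
move=> [dV _] dphi.
have dp : differentiable phi t by apply/derivable1_diffP; exact: ex_derive.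
have dc : differentiable (V \o phi) t by exact: differentiable_comp.
apply: DeriveDef; first exact/derivable1_diffP.
rewrite deriveE// diff_comp//= -[X in 'd V _ X]deriveE// derive_val.
rewrite {1}[f (phi t)]row_sum_delta linear_sum /lie; apply: eq_bigr => i _.
by rewrite linearZ/= mxE deriveE// mulrC.
Qed.

Lemma lie_continuous (R : realType) n (f : 'rV[R]_n -> 'rV[R]_n) (V : 'rV[R]_n -> R) :
  continuous f -> C1 V -> continuous (lie f V).
Proof.
move=> cf [_ cV].
have -> : lie f V = \sum_(i < n) (fun x => grad V x 0 i * f x 0 i).
  by apply/funext => x; rewrite fct_sumE.
elim/big_ind : _ => [|u v cu cv|i _] x; first exact: cst_continuous.
  by apply: continuousD; [exact: cu|exact: cv].
apply: (@continuousM R _ (fun x => grad V x 0 i) (fun x => f x 0 i)).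
  by apply: (@continuous_comp _ _ _ (grad V) (fun v : 'rV[R]_n => v 0 i));
    [exact: cV|exact: coord_continuous].
by apply: (@continuous_comp _ _ _ f (fun v : 'rV[R]_n => v 0 i));
  [exact: cf|exact: coord_continuous].
Qed.

Lemma C1_continuous (R : realType) n (V : 'rV[R]_n -> R) : C1 V -> continuous V.
Proof. by move=> [dV _] x; exact: differentiable_continuous. Qed.

Lemma first_hit (R : realType) (u : R -> R) (r t : R) : continuous u ->
  u 0 < r -> 0 <= t -> r <= u t ->
  exists2 T, 0 <= T <= t & u T = r /\ forall s, 0 <= s <= T -> u s <= r.
Proof.
move=> cu u0 t0 rt.
pose A := `[0, t] `&` (u @^-1` [set y | r <= y]).
have cA : compact A.
  apply: (subclosed_compact _ (@segment_compact R 0 t)); last by move=> ? [].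
  apply: closedI; first exact: interval_closed.
  by apply: preimage_closed => //; exact: closed_ge.
have A0 : A !=set0 by exists t; split=> //=; rewrite in_itv/= t0 lexx.
have [T] := @compact_EVT_min R _ (id : R ->
  R) A A0 cA (continuous_subspaceT (fun x => cvg_id)).
rewrite inE => -[/=]; rewrite in_itv/= => /andP[T0 Tt] rT Tmin.
have below s : 0 <= s -> s < T -> u s < r.
  move=> s0 sT; rewrite ltNge; apply/negP => rs.
  have /Tmin : s \in A.
    by rewrite inE; split=> //=; rewrite in_itv/= s0 (le_trans (ltW sT)).
  by rewrite leNgt sT.
have uT : u T = r.
  (* If [u T > r], then [T > 0] because [u 0 < r], and by continuity [u] still exceeds [r] slightly
     before [T], against minimality. *)
  apply/eqP; rewrite eq_le rT andbT leNgt; apply/negP => rltT.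
  have T00 : 0 < T.
    by rewrite lt_neqAle T0 andbT; apply: contraTneq rT => <-; rewrite -ltNge.
  have /cvgrPdist_lt/(_ (u T - r)) := cu T; rewrite subr_gt0 => /(_ rltT).
  move=> /nbhs_ballP[d /= d0 hd].
  have [s /andP[s1 s2]] : exists s, Num.max 0 (T - d) < s < T.
    exists ((Num.max 0 (T - d) + T) / 2); apply/andP; split.
      by rewrite ltr_pdivlMr// mulr_natr mulr2n ltrD2l gt_max T00 ltrBlDr ltrDl.
    by rewrite ltr_pdivrMr// mulr_natr mulr2n ltrD2r gt_max T00 ltrBlDr ltrDl.
  move: s1; rewrite gt_max => /andP[s0 sd].
  have := hd s; rewrite /ball/= => /(_ _)/(le_lt_trans (ler_norm _)) h.
  have := below s (ltW s0) s2.
  have : u T - u s < u T - r by apply: h; rewrite gtr0_norm ?subr_gt0//; lra.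
  lra.
exists T; first by rewrite T0.
by split=> // s /andP[s0]; rewrite le_eqVlt => /predU1P[->|sT];
  [rewrite uT|exact/ltW/below].
Qed.

(* A function can only be pushed above [m] while it is at or below [m]:
   look at the last time it is at most [m]. *)
Lemma barrier (R : realType) (u du : R -> R) (m a b : R) : a <= b ->
  continuous u -> u a <= m ->
  (forall s, a <= s <= b -> is_derive s (1 : R) u (du s)) ->
  (forall s, a <= s <= b -> m < u s -> du s <= 0) -> u b <= m.
Proof.
move=> ab cu ua hd hle; rewrite leNgt; apply/negP => mb.
pose A := `[a, b] `&` (u @^-1` [set y | y <= m]).
have cA : compact A.
  apply: (subclosed_compact _ (@segment_compact R a b)); last by move=> ? [].
  apply: closedI; first exact: interval_closed.
  by apply: preimage_closed => //; exact: closed_le.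
have A0 : A !=set0 by exists a; split=> //=; rewrite in_itv/= lexx ab.
have [c] := @compact_EVT_max R _ (id : R ->
  R) A A0 cA (continuous_subspaceT (fun x => cvg_id)).
rewrite inE => -[/=]; rewrite in_itv/= => /andP[ac cb] cm cmax.
have : u b <= u c.
  apply: (@nincr_of_derive _ u du) => //.
  - by move=> s /andP[cs sb]; apply: hd; rewrite (le_trans ac (ltW cs)) ltW.
  - move=> s /andP[cs sb].
    have sab : a <= s <= b by rewrite (le_trans ac (ltW cs)) ltW.
    apply: hle => //; rewrite ltNge; apply/negP => sm.
    have /cmax : s \in A by rewrite inE; split=> //=; rewrite in_itv.
    by rewrite leNgt cs.
  - exact: continuous_subspaceT.
by move=> /le_trans/(_ cm); rewrite leNgt mb.
Qed.

(** Confinement is known only along solutions of [f], whereas [phi] solves the truncated field. Up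
    to the first time its norm reaches [r] it does solve [f], hence lies in [K] at that time; but
    [K] is strictly inside the box of radius [r]. *)
Lemma bounded_flow (R : realType) n (f : 'rV[R]_n -> 'rV[R]_n) (K : set 'rV[R]_n) x0 :
  locally_lipschitz f -> compact K -> K x0 ->
  (forall (phi : R -> 'rV[R]_n) (T : R), 0 <= T -> phi 0 = x0 -> continuous phi ->
     (forall s : R, 0 <= s <= T -> is_derive s (1 : R) phi (f (phi s))) ->
       K (phi T)) ->
  exists (F : 'rV[R]_n -> 'rV[R]_n) (L : R) (phi : R -> 'rV[R]_n),
    [/\ 0 < L, (forall x y, `|F x - F y| <= L * `|x - y|),
        (forall x, K x -> F x = f x),
        phi 0 = x0 /\ (forall t, is_derive t (1 : R) phi (F (phi t))) &
        forall t : R, 0 <= t -> K (phi t)].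
Proof.
move=> fl cK Kx0 conf.
have [r r0 Kr] : exists2 r : R, 0 < r & forall x, K x -> `|x| < r.
  have [M [_ hM]] := compact_bounded cK.
  (* Every constant above [M] bounds [K], in particular [|M| + 1]; one unit more makes the bound
     strict. *)
  exists (`|M| + 2); first by rewrite ltr_wpDl.
  move=> x Kx; apply: le_lt_trans (_ : `|M| + 1 < _); last by rewrite ltrD2l ltr1n.
  by apply: hM => //; rewrite (le_lt_trans (ler_norm M))// ltrDl.
have [F [L L0 [FL Ff]]] := lipschitz_truncation (ltW r0) fl.
have [phi [phi0 dphi]] := picard_global L0 FL x0.
have cphi : continuous phi by move=> t; exact: (is_derive_continuous (dphi t)).
have inK T : 0 <= T -> (forall s, 0 <= s <= T -> `|phi s| <= r) -> K (phi T).
  by move=> T0 h; apply: conf => // s sT; rewrite -Ff//; exact: h.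
have bnd t : 0 <= t -> `|phi t| < r.
  move=> t0; rewrite ltNge; apply/negP => rt.
  have [||//|//|T /andP[T0 Tt] [uT hT]] := @first_hit R (fun s => `|phi s|) r t.
  - move=> s; apply: (@continuous_comp _ _ _ phi (fun v => `|v|)); first exact: cphi.
    exact: norm_continuous.
  - by rewrite phi0; exact: Kr.
  by have := Kr _ (inK T T0 hT); rewrite uT ltxx.
exists F, L, phi; split => //.
  by move=> x /Kr/ltW; exact: Ff.
by move=> t t0; apply: inK => // s /andP[s0 _]; exact/ltW/bnd.
Qed.

(** * Invariance of limit sets and monotone quantities *)

Lemma near_dist_lt (R : realType) n (h : 'rV[R]_n -> R) (p : 'rV[R]_n) (e : R) :
  {for p, continuous h} -> 0 < e -> \forall x \near p, `|h p - h x| < e.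
Proof. by move=> /(@cvgrPdist_lt R R 'rV[R]_n (nbhs p) (nbhs_filter p)); exact. Qed.

(** Continuous dependence on the initial point: the translates of [phi] by [tau i] start close to
    [psi 0], so at a fixed time of either sign they are close to [psi]. *)
Lemma omega_limit_flow_invariant (R : realType) n (F : 'rV[R]_n -> 'rV[R]_n) (L : R)
    (phi psi : R -> 'rV[R]_n) :
  0 < L -> (forall x y, `|F x - F y| <= L * `|x - y|) ->
  (forall t, is_derive t (1 : R) phi (F (phi t))) ->
  (forall t, is_derive t (1 : R) psi (F (psi t))) ->
  omega_limit phi (psi 0) -> forall t, omega_limit phi (psi t).
Proof.
move=> L0 FL dphi dpsi [tau tauy ptau] t.
have [c [T [c1 T0 ->]]] : exists c T : R, [/\ `|c| = 1, 0 <= T & t = c * T + 0].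
  have [t0|t0] := leP 0 t; first by exists 1, t; rewrite normr1 mul1r addr0.
  by exists (-1), (- t); rewrite normrN1 mulN1r opprK addr0 oppr_ge0 ltW.
set s := c * T + 0.
have spsi : is_solution F setT (psi 0) psi.
  by apply: is_derive_solution => // u _.
have sphi i : is_solution F setT (phi (1 * 0 + tau i)) (fun u => phi (1 * u + tau i)).
  apply: is_derive_solution => // u _; rewrite -[F _]scale1r.
  exact: is_derive_comp_affine.
exists (fun i => s + tau i).
  apply/cvgryPge => M; have /cvgryPge/(_ (M - s)) := tauy.
  by apply: filterS => i; rewrite lerBlDl.
pose C := expR (2 * L * n%:R * T).
have C0 : 0 < C by exact: expR_gt0.
apply/cvgrPdist_lt => e e0.
(* The denominator is chosen because [C < (C + 1) ^ 2], so the squared initial distance times [C]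
   stays below [e ^ 2]. *)
have d0 : 0 < e / (C + 1) by rewrite divr_gt0// addr_gt0.
have dC : C * (e / (C + 1)) ^+ 2 < e ^+ 2.
  rewrite expr_div_n mulrCA -[ltRHS]mulr1 ltr_pM2l ?exprn_gt0//.
  rewrite ltr_pdivrMr ?exprn_gt0 ?addr_gt0// mul1r; nra.
have near_i : \forall i \near \oo, enorm (phi (tau i) - psi 0) < e / (C + 1) :=
  ptau _ (near_enorm_lt (psi 0) d0).
apply: filterS near_i => i hi.
have h := solution_dist c1 T0 (ltW L0) (fun _ _ => I)
  (sphi i) spsi (fun u _ => FL _ _).
rewrite -/s -/C mul1r mulr0 add0r in h.
rewrite distrC -(ltr_pXn2r (n := 2))// ?nnegrE ?(ltW e0)//.
apply: (le_lt_trans _ dC); apply: le_trans (le_trans h _).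
  by rewrite ler_pXn2r ?nnegrE ?sqrtr_ge0// norm_le_enorm.
by rewrite ler_wpM2l ?(ltW C0)// ler_pXn2r ?nnegrE ?sqrtr_ge0 ?(ltW d0)// ltW.
Qed.

(** Two functions are allowed because [theta] at a later time is compared with [theta + g (V _)] at
    an earlier one. Both limit points are approached at arbitrarily late times, so the two times can
    be taken in either order. *)
Lemma omega_limit_le (R : realType) n (phi : R -> 'rV[R]_n) (h k : 'rV[R]_n ->
  R) p q (T : R) :
  omega_limit phi p -> omega_limit phi q ->
  {for q, continuous h} -> {for p, continuous k} ->
  (forall s t, T <= s <= t -> h (phi t) <= k (phi s)) -> h q <= k p.
Proof.
rewrite omega_limitE => wp wq ch ck hk; rewrite leNgt; apply/negP => kh.
pose e := (h q - k p) / 2.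
have e0 : 0 < e by rewrite divr_gt0// subr_gt0.
have near_w r (u : 'rV[R]_n -> R) : cluster (phi @ +oo) r -> {for r, continuous u} ->
    forall s, exists2 t, s <= t & `|u r - u (phi t)| < e.
  move=> wr cu s.
  have nA : (phi @ +oo) (phi @` [set t | s <= t]).
    by apply: filterS (nbhs_pinfty_ge (num_real s)) => t st; exists t.
  have nB : nbhs r [set v | `|u r - u v| < e].
    exact: near_dist_lt.
  by have [_ [[t st <-] ut]] := wr _ _ nA nB; exists t.
have [s Ts] := near_w p k wp ck T.
have [t st] := near_w q h wq ch s.
have := hk s t; rewrite Ts st => /(_ isT).
rewrite !ltr_norml /e => ? /andP[? ?] /andP[? ?]; lra.
Qed.

Lemma Kinfty_ge0 (R : realType) (g : R -> R) s : class_Kinfty g -> 0 <= s -> 0 <= g s.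
Proof.
move=> [_ gm _ g0]; rewrite le_eqVlt => /predU1P[<-|s0]; first by rewrite g0.
by rewrite -g0; apply/ltW/gm.
Qed.

(** At 0 the function [g] is continuous only from the right, its values at negative arguments being
    arbitrary; [V >= 0] makes this enough. *)
Lemma Kinfty_comp_continuous (R : realType) n (g : R -> R) (V : 'rV[R]_n -> R) p :
  class_Kinfty g -> continuous V -> (forall x, 0 <= V x) -> V p = 0 ->
  {for p, continuous (g \o V)}.
Proof.
move=> [gc _ _ g0] cV V0 Vp.
apply/(@cvgrPdist_lt R R 'rV[R]_n (nbhs p) (nbhs_filter p)) => e e0.
have := (subspace_continuousP _ g).1 gc 0; rewrite /= in_itv/= lexx => /(_ isT).
move=> /cvgrPdist_lt/(_ e e0); rewrite /within/= => hg.
have := cV p; rewrite /continuous_at Vp => /(_ _ hg) near_p.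
have {near_p} : \forall x \near p, `[0, +oo[%classic (V x) ->
  `|g 0 - g (V x)| < e := near_p.
by apply: filterS => x; rewrite /= in_itv/= andbT; apply.
Qed.

(** * Growth of [V] and [theta] along trajectories *)

Section lyapunov.
Variables (R : realType) (n : nat) (f : 'rV[R]_n -> 'rV[R]_n).
Variables (V theta : 'rV[R]_n -> R).
Hypothesis f_lip : locally_lipschitz f.
Hypotheses (V_C1 : C1 V) (theta_C1 : C1 theta).
Hypothesis V_decr : forall x, lie f V x <= 0.
Hypothesis theta_decr : forall x, lie f V x = 0 -> lie f theta x <= 0.
Hypothesis V_ge0 : forall x, 0 <= V x.
Hypothesis SV : forall x, lie f V x = 0 <-> V x = 0.

Lemma lyapunov_nincr (phi : R -> 'rV[R]_n) (a b : R) : a <= b ->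
  (forall s, a <= s <= b -> is_derive s (1 : R) phi (f (phi s))) ->
  V (phi b) <= V (phi a).
Proof.
move=> ab dphi.
apply: (@nincr_of_derive_cc _ (fun s => V (phi s)) (fun s => lie f V (phi s))) => //.
by move=> s sab; apply: is_derive_lie => //; exact: dphi.
Qed.

(* While [V > 0] the growth condition makes [theta + g (V _)] nonincreasing;
   once [V = 0] the trajectory stays in [S], where [theta] is nonincreasing. *)
Lemma theta_growth_bound (K : set 'rV[R]_n) (g : R -> R) (delta : R)
    (phi : R -> 'rV[R]_n) (a b : R) : a <= b ->
  class_Kinfty g -> C1_pos g ->
  (forall x, K x -> 0 < V x -> V x <= delta -> `|lie f V x| <= delta ->
     lie f theta x <= derive1 g (V x) * `|lie f V x|) ->
  continuous phi ->
  (forall s, a <= s <= b -> is_derive s (1 : R) phi (f (phi s))) ->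
  (forall s, a <= s <= b -> [/\ K (phi s), V (phi s) <= delta &
                               `|lie f V (phi s)| <= delta]) ->
  theta (phi b) <= theta (phi a) + g (V (phi a)).
Proof.
move=> ab gK gC1 hg cphi dphi hphi.
have ctheta : continuous (fun s => theta (phi s)).
  by move=> s; apply: (@continuous_comp _ _ _ phi theta);
    [exact: cphi|exact: C1_continuous].
apply: (@barrier _ (fun s => theta (phi s)) (fun s =>
  lie f theta (phi s)) _ a b ab ctheta).
- by rewrite lerDl Kinfty_ge0.
- by move=> s sab; apply: is_derive_lie => //; exact: dphi.
move=> s /andP[as1 sb] hs; apply: theta_decr; apply/SV; apply/eqP.
(* It remains to rule out [V > 0] at time [s] while [theta] is above the barrier. By monotonicity
   [V] would be positive on all of [[a, s]], where [g] can be differentiated, and the resulting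
   decrease puts [theta (phi s)] below the barrier. *)
rewrite eq_le V_ge0 andbT leNgt; apply/negP => Vs.
suff : theta (phi s) + g (V (phi s)) <= theta (phi a) + g (V (phi a)).
  by have := Kinfty_ge0 gK (V_ge0 (phi s)); lra.
have inab u : a <= u <= s -> a <= u <= b by move=> /andP[-> /le_trans->].
have Vpos u : a <= u <= s -> 0 < V (phi u).
  move=> /andP[au us]; apply: (lt_le_trans Vs);
    apply: lyapunov_nincr => // v /andP[uv vs].
  by apply: dphi; rewrite (le_trans au uv) (le_trans vs).
apply: (@nincr_of_derive_cc _ (fun u => theta (phi u) + g (V (phi u)))
  (fun u => lie f theta (phi u) + derive1 g (V (phi u)) * lie f V (phi u))) => //.
- move=> u ua; have du := dphi u (inab u ua).
  have [gd _] := gC1 _ (Vpos u ua).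
  have dg : is_derive (V (phi u)) (1 : R) g (derive1 g (V (phi u))).
    by rewrite derive1E; exact/derivableP.
  have dV := is_derive_lie V_C1 du.
  have dth := is_derive_lie theta_C1 du.
  exact: (@is_deriveD _ _ _ _ _ _ _ _ _ dth (@is_derive1_comp _ g (fun s =>
    V (phi s)) u _ _ dg dV)).
- move=> u ua; have [Ku Vu lu] := hphi u (inab u ua).
  have := hg _ Ku (Vpos u ua) Vu lu.
  by rewrite (ler0_norm (V_decr (phi u))) mulrN -subr_le0 opprK.
Qed.

End lyapunov.

Lemma lie_eq0_of_constant (R : realType) n (f : 'rV[R]_n -> 'rV[R]_n) (h :
  'rV[R]_n -> R)
    (psi : R -> 'rV[R]_n) :
  C1 h -> is_derive 0 (1 : R) psi (f (psi 0)) -> (forall t, h (psi t) = h (psi 0)) ->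
  lie f h (psi 0) = 0.
Proof.
move=> hC dpsi hc; have dh := is_derive_lie hC dpsi.
have e : (fun s => h (psi s)) = cst (h (psi 0)) by apply/funext => s; rewrite hc.
by rewrite -(derive_val (is_derive := dh)) e derive_cst.
Qed.

(** * Limit sets and stability under the growth condition *)

Section lasalle.
Variables (R : realType) (n : nat) (f : 'rV[R]_n -> 'rV[R]_n).
Variables (V theta : 'rV[R]_n -> R).
Hypothesis f_lip : locally_lipschitz f.
Hypotheses (V_C1 : C1 V) (theta_C1 : C1 theta).
Hypothesis V_decr : forall x, lie f V x <= 0.
Hypothesis theta_decr : forall x, lie f V x = 0 -> lie f theta x <= 0.
Hypothesis V_ge0 : forall x, 0 <= V x.
Hypothesis SV : forall x, lie f V x = 0 <-> V x = 0.
Hypothesis theta_growth : forall K : set 'rV[R]_n, compact K ->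
  (exists2 x, K x & V x = 0) ->
  exists (g : R -> R) (delta : R),
    [/\ class_Kinfty g, C1_pos g, 0 < delta &
        forall x, K x -> 0 < V x -> V x <= delta ->
          `|lie f V x| <= delta ->
          lie f theta x <= derive1 g (V x) * `|lie f V x|].

Section omega.
Variables (K : set 'rV[R]_n) (F : 'rV[R]_n -> 'rV[R]_n) (L : R) (phi : R -> 'rV[R]_n).
Hypothesis cK : compact K.
Hypothesis L0 : 0 < L.
Hypothesis F_lip : forall x y, `|F x - F y| <= L * `|x - y|.
Hypothesis FK : forall x, K x -> F x = f x.
Hypothesis dphi : forall t, is_derive t (1 : R) phi (F (phi t)).
Hypothesis phiK : forall t : R, 0 <= t -> K (phi t).

Let cphi : continuous phi.
Proof. by move=> t; exact: (is_derive_continuous (dphi t)). Qed.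

Let phi_f (t : R) : 0 <= t -> is_derive t (1 : R) phi (f (phi t)).
Proof. by move=> t0; rewrite -FK//; exact: phiK. Qed.

Let phiK_near : \forall t \near +oo, K (phi t).
Proof. by apply: filterS (nbhs_pinfty_ge (num_real 0)) => t; exact: phiK. Qed.

(** The truncated field has a solution through [p] for all times, and invariance keeps it in the
    limit set, hence in [K], where [F] and [f] agree. This yields a solution of [f] in backward time
    as well. *)
Lemma omega_limit_entire_solution p : omega_limit phi p ->
  exists psi : R -> 'rV[R]_n, [/\ psi 0 = p,
    (forall t, is_derive t (1 : R) psi (f (psi t))) & forall t,
      omega_limit phi (psi t)].
Proof.
move=> wp; have [psi [psi0 dpsi]] := picard_global L0 F_lip p.
have wpsi t : omega_limit phi (psi t).
  by apply: (@omega_limit_flow_invariant _ _ F L phi psi) => //; rewrite psi0.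
exists psi; split=> // t; rewrite -FK//.
exact: (omega_limit_sub cK phiK_near (wpsi t)).
Qed.

Lemma omega_limit_V p : omega_limit phi p -> V p = 0.
Proof.
move=> wp; have cV := C1_continuous V_C1.
have const q : omega_limit phi q -> V q = V p.
  move=> wq; apply/eqP; rewrite eq_le.
  have Vle (s t : R) : 0 <= s <= t -> V (phi t) <= V (phi s).
    move=> /andP[s0 st]; apply: (lyapunov_nincr V_C1 V_decr st) => u /andP[su _].
    by apply: phi_f; exact: le_trans su.
  by apply/andP; split; apply: (@omega_limit_le _ _ phi V V _ _ 0) => //; exact: cV.
have [psi [psi0 dpsi wpsi]] := omega_limit_entire_solution wp.
apply/SV; rewrite -psi0; apply: lie_eq0_of_constant => // t.
by rewrite psi0; exact: const.
Qed.

Lemma omega_limit_theta p : omega_limit phi p -> lie f theta p = 0.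
Proof.
move=> wp; have cV := C1_continuous V_C1.
have ctheta := C1_continuous theta_C1.
have Kp : K p := omega_limit_sub cK phiK_near wp.
have [g [delta [gK gC1 d0 hg]]] :=
  theta_growth cK (ex_intro2 _ _ p Kp (omega_limit_V wp)).
have cl := lie_continuous (locally_lipschitz_continuous f_lip) V_C1.
pose U := [set x | V x < delta /\ `|lie f V x| < delta].
have wU : omega_limit phi `<=` U°.
  move=> q wq; have Vq := omega_limit_V wq; have lq : lie f V q = 0 by apply/SV.
  apply: filterI.
    by apply: filterS (near_dist_lt (cV q) d0) => x; rewrite /= Vq sub0r normrN;
      exact: le_lt_trans (ler_norm _).
  by apply: filterS (near_dist_lt (cl q) d0) => x; rewrite /= lq sub0r normrN.
have [T [_ hT]] := omega_limit_attracts cK phiK_near (open_interior _) wU.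
(* The tail bound holds strictly after [T], hence the [+ 1]; the maximum with 0 is there because
   [phi] is known to solve [f] only at nonnegative times. *)
pose T0 := Num.max 0 (T + 1).
have hT0 s : T0 <= s -> [/\ 0 <= s, V (phi s) <= delta & `|lie f V (phi s)| <= delta].
  rewrite ge_max => /andP[s0 Ts].
  have /interior_subset[/ltW ? /ltW ?] : U° (phi s) by apply: hT;
    rewrite (lt_le_trans _ Ts)// ltrDl.
  by [].
have const q : omega_limit phi q -> theta q = theta p.
  move=> wq.
  have le a b : omega_limit phi a -> omega_limit phi b -> theta b <= theta a.
    move=> wa wb; have Va := omega_limit_V wa; have [_ _ _ g0] := gK.
    have := @omega_limit_le _ _ phi theta (theta \+ (g \o V)) a b T0 wa wb (ctheta b).
    rewrite /= Va g0 addr0; apply.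
      apply: continuousD; first exact: ctheta.
      exact: Kinfty_comp_continuous.
    move=> s t /andP[sT st].
    apply: (@theta_growth_bound _ _ f V theta _ _ _ _ _ _ K g delta phi) => //.
      by move=> u /andP[su _]; apply: phi_f; have [] := hT0 u (le_trans sT su).
    move=> u /andP[su _]; have [u0 ? ?] := hT0 u (le_trans sT su).
    by split=> //; exact: phiK.
  by apply/eqP; rewrite eq_le !le.
have [psi [psi0 dpsi wpsi]] := omega_limit_entire_solution wp.
rewrite -psi0; apply: lie_eq0_of_constant => // t.
by rewrite psi0; exact: const.
Qed.

End omega.

(** A property valid near each zero of [V] in [K] becomes uniform on thin sublevel sets: around any
    other point [V] exceeds half its value there, so for smaller [mu] the sublevel condition
    fails. *)
Lemma near_zero_sublevel (K : set 'rV[R]_n) (Q : R -> 'rV[R]_n -> Prop) : compact K ->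
  (forall x, K x -> V x = 0 -> \forall x' \near x & mu \near 0^'+, Q mu x') ->
  \forall mu \near 0^'+, forall x, K x -> V x <= mu -> Q mu x.
Proof.
move=> cK hQ; have cV := C1_continuous V_C1.
have /compact_near_coveringP/(_ R 0^'+ (fun mu x => V x <= mu -> Q mu x) _) := cK.
case=> [x Kx|d d0 hd]; last by exists d => // mu mud mu0 x Kx; exact: hd.
have [Vx|Vx] := eqVneq (V x) 0.
  by apply: filterS (hQ x Kx Vx) => -[].
have Vx0 : 0 < V x / 2 by rewrite divr_gt0// lt_neqAle eq_sym Vx V_ge0.
exists ([set x' | V x / 2 < V x'], [set mu | mu < V x / 2]).
  split=> /=; last exact: nbhs_right_lt.
  by apply: filterS (near_dist_lt (cV x) Vx0) => y;
    rewrite /= ltr_norml => /andP[_]; lra.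
by move=> [y mu] [/= h1 h2] h3; have := lt_le_trans h1 h3; rewrite ltNge (ltW h2).
Qed.

Lemma closed_ball_rV_compact (a : 'rV[R]_n) (e : R) : compact [set x | `|x - a| <= e].
Proof.
have cn : continuous (fun x : 'rV[R]_n => `|x - a|).
  move=> x; apply/(@cvgrPdist_lt R R 'rV[R]_n (nbhs x) (nbhs_filter x)) => d d0.
  apply: filterS (near_norm_lt x d0) => y; apply: le_lt_trans.
  by rewrite (le_trans (ler_dist_dist _ _))// opprB addrA subrK.
apply: (subclosed_compact _ (@box_compact _ _ (e + `|a|))).
  have -> : [set x | `|x - a| <= e] = (fun x : 'rV[R]_n =>
    `|x - a|) @^-1` [set y | y <= e] by [].
  by apply: preimage_closed => //; exact: closed_le.
move=> x /= xe; rewrite -[x](subrK a) (le_trans (ler_normD _ _))// lerD2r//.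
Qed.

Lemma stability_nbhd (xs : 'rV[R]_n) (e : R) : 0 < e -> V xs = 0 ->
  (forall x, V x = 0 -> x <> xs -> `|x - xs| <= e -> theta xs < theta x) ->
  \forall x0 \near xs, forall phi : R -> 'rV[R]_n, phi 0 = x0 -> continuous phi ->
    (forall t : R, 0 <= t -> is_derive t (1 : R) phi (f (phi t))) ->
    forall t : R, 0 <= t -> `|phi t - xs| < e.
Proof.
move=> e0 Vxs hmin.
have cV := C1_continuous V_C1; have ctheta := C1_continuous theta_C1.
pose K := [set x : 'rV[R]_n | `|x - xs| <= e].
have cK : compact K by exact: closed_ball_rV_compact.
have Kxs : K xs by rewrite /K/= subrr normr0 ltW.
have [g [delta [gK gC1 d0 hg]]] := theta_growth cK (ex_intro2 _ _ xs Kxs Vxs).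
have cl := lie_continuous (locally_lipschitz_continuous f_lip) V_C1.
have h1 : \forall mu \near 0^'+, forall x, K x -> V x <= mu -> `|lie f V x| <= delta.
  apply: near_zero_sublevel => // x Kx /SV lx.
  exists ([set y | `|lie f V y| <= delta], setT); last by move=> [y mu] [].
  split=> /=; last exact: filterT.
  by apply: filterS (near_dist_lt (cl x) d0) => y; rewrite /= lx sub0r normrN => /ltW.
(* The same [mu] is the level of [V] and the gap of [theta] on the sphere. A start with
   [W x0 < theta xs + mu] then contradicts [theta_growth_bound] if the sphere is reached. *)
have h2 : \forall mu \near 0^'+, forall x, K x -> V x <= mu ->
    `|x - xs| = e -> theta xs + mu < theta x.
  apply: near_zero_sublevel => // x Kx Vx.
  have [->|/eqP xxs] := eqVneq x xs.
    exists ([set y | `|xs - y| < e], setT).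
      by split=> /=; [exact: near_norm_lt|exact: filterT].
    by move=> [y mu] [/= ye _] ye'; move: ye; rewrite distrC ye' ltxx.
  pose d := (theta x - theta xs) / 2.
  have dd0 : 0 < d by rewrite divr_gt0// subr_gt0; exact: hmin.
  exists ([set y | `|theta x - theta y| < d], [set mu | mu < d]).
    split=> /=; last exact: nbhs_right_lt.
    exact: (near_dist_lt (ctheta x) dd0).
  by move=> [y mu] [/=]; rewrite ltr_norml /d => /andP[? ?] ? _; lra.
have [mu [[hmu1 hmu2] [mu0 mud]]] :=
  filter_ex (filterI (filterI h1 h2) (filterI (nbhs_right_gt (0 :
    R)) (nbhs_right_le d0))).
pose W := theta \+ (g \o V).
have cW : {for xs, continuous W}.
  by apply: continuousD; [exact: ctheta|exact: Kinfty_comp_continuous].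
have Wxs : W xs = theta xs by have [_ _ _ g0] := gK; rewrite /W/= Vxs g0 addr0.
have n1 : \forall x \near xs, V x < mu.
  by apply: filterS (near_dist_lt (cV xs) mu0) => x; rewrite /= Vxs sub0r normrN;
    exact: le_lt_trans (ler_norm _).
have n2 : \forall x \near xs, W x < theta xs + mu.
  by apply: filterS (near_dist_lt cW mu0) => x;
    rewrite /= Wxs ltr_norml => /andP[]; lra.
apply: filterS (filterI (near_norm_lt xs e0) (filterI n1 n2)) => x0 [x0e [Vx0 Wx0]].
move=> phi phi0 cphi dphi t t0; rewrite ltNge; apply/negP => et.
have [||//|//|T /andP[T0 Tt] [uT hT]] := @first_hit R (fun s => `|phi s - xs|) e t.
- by move=> s; apply: cvg_norm; apply: cvgB; [exact: cphi|exact: cvg_cst].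
- by rewrite phi0 distrC.
have Vs (s : R) : 0 <= s -> V (phi s) <= mu.
  move=> s0; apply: (@le_trans _ _ (V x0)); last exact: ltW.
  rewrite -phi0; apply: (lyapunov_nincr V_C1 V_decr s0) => u /andP[u0 _]; exact: dphi.
have := theta_growth_bound V_C1 theta_C1 V_decr theta_decr V_ge0 SV T0 gK gC1 hg cphi.
have hphi (s : R) : 0 <= s <= T ->
    [/\ K (phi s), V (phi s) <= delta & `|lie f V (phi s)| <= delta].
  move=> sT; have Ks : K (phi s) by exact: hT.
  have Vmu : V (phi s) <= mu by apply: Vs; case/andP: sT.
  by split=> //; [exact: le_trans mud|exact: hmu1].
have dphiT (s : R) : 0 <= s <= T -> is_derive s (1 : R) phi (f (phi s)).
  by move=> /andP[s0 _]; exact: dphi.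
move=> /(_ dphiT hphi) hle.
have KT : K (phi T) by apply: hT; rewrite T0 lexx.
have := hmu2 (phi T) KT (Vs T T0) uT.
move: Wx0; rewrite /W/= -phi0; lra.
Qed.

End lasalle.

Unset Implicit Arguments.
Set Strict Implicit.

Theorem theorem3p3 (R : realType) (n : nat) (f : 'rV[R]_n -> 'rV[R]_n)
    (V theta : 'rV[R]_n -> R) (S : set 'rV[R]_n)
    (f_lip : locally_lipschitz f)
    (V_C1 : C1 V) (theta_C1 : C1 theta)
    (V_decr : forall x, lie f V x <= 0)
    (theta_decr : forall x, lie f V x = 0 -> lie f theta x <= 0)
    (sublevel_compact : forall z y, V y <= V z ->
       compact [set x | V x <= V z /\ theta x <= theta y])
    (sublevel_cover : forall z : 'rV[R]_n, exists yz : 'rV[R]_n,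
       [/\ V yz <= V z, theta z <= theta yz &
           [set x | V x <= V z] `<=`
             [set x | theta x <= theta yz] `|` [set x | lie f theta x <= 0]])
    (V_ge0 : forall x, 0 <= V x)
    (S_def : S = [set x | lie f V x = 0])
    (S_zeroV : S = [set x | V x = 0])
    (theta_growth : forall K : set 'rV[R]_n, compact K -> K `&` S !=set0 ->
       exists (g : R -> R) (delta : R),
         [/\ class_Kinfty g, C1_pos g, 0 < delta &
             forall x, K x -> 0 < V x -> V x <= delta ->
               `|lie f V x| <= delta ->
               lie f theta x <= derive1 g (V x) * `|lie f V x|]) :
  [/\ forall x0 : 'rV[R]_n, exists2 x : R -> 'rV[R]_n,
        is_unique_solution f `[0, +oo[%classic x0 x &
        [bounded x t | t in `[0, +oo[%classic],
      positively_invariant f S,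
      forall (x0 : 'rV[R]_n) (x : R -> 'rV[R]_n),
        is_unique_solution f `[0, +oo[%classic x0 x ->
        [/\ omega_limit x !=set0, compact (omega_limit x),
            connected (omega_limit x), invariant_set f (omega_limit x) &
            omega_limit x `<=` [set y | V y = 0 /\ lie f theta y = 0]] &
      forall xs : 'rV[R]_n, S xs -> equilibrium f xs ->
        (exists2 del : R, 0 < del &
           (forall x, S x -> x <> xs -> enorm (x - xs) < del ->
              theta xs < theta x) /\
           [set x | [/\ S x, lie f theta x = 0 & enorm (x - xs) < del]]
             = [set xs]) ->
        locally_asymptotically_stable f xs].
Proof.
have SV x : lie f V x = 0 <-> V x = 0.
  have e : [set x | lie f V x = 0] = [set x | V x = 0] by rewrite -S_def.
  by have := congr1 (fun A : set 'rV[R]_n => A x) e; rewrite /= => ->.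
have inS x : S x <-> V x = 0 by rewrite S_zeroV.
have growth (K : set 'rV[R]_n) : compact K -> (exists2 x, K x & V x = 0) ->
    exists (g : R -> R) (delta : R),
      [/\ class_Kinfty g, C1_pos g, 0 < delta &
          forall x, K x -> 0 < V x -> V x <= delta -> `|lie f V x| <= delta ->
            lie f theta x <= derive1 g (V x) * `|lie f V x|].
  by move=> cK [x Kx Vx]; apply: theta_growth => //; exists x; split=> //; apply/inS.
have flow (x0 : 'rV[R]_n) : exists (K : set 'rV[R]_n) (F : 'rV[R]_n -> 'rV[R]_n)
    (L : R) (phi : R -> 'rV[R]_n), compact K /\
    [/\ 0 < L, (forall x y, `|F x - F y| <= L * `|x - y|),
        (forall x, K x -> F x = f x),
        phi 0 = x0 /\ (forall t, is_derive t (1 : R) phi (F (phi t))) &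
        forall t : R, 0 <= t -> K (phi t)].
  (* The point [y] provides the barrier [theta y]: on the sublevel set of [V], which the trajectory
     cannot leave, [theta] above this level has nonpositive derivative. *)
  have [y [Vy thy cov]] := sublevel_cover x0.
  exists [set x | V x <= V x0 /\ theta x <= theta y].
  have cK := sublevel_compact x0 y Vy.
  have [//|phi T T0 phi0 cphi dphi|F [L [phi hphi]]] :=
    @bounded_flow _ _ f [set x | V x <= V x0 /\ theta x <= theta y] x0 f_lip cK;
      last first.
    by exists F, L, phi.
  have Vle (s : R) : 0 <= s <= T -> V (phi s) <= V x0.
    move=> /andP[s0 sT]; rewrite -phi0.
    apply: (lyapunov_nincr V_C1 V_decr s0) => u /andP[u0 us].
    by apply: dphi; rewrite u0 (le_trans us).
  split=> /=; first by apply: Vle; rewrite T0 lexx.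
  apply: (@barrier _ (fun s => theta (phi s)) (fun s =>
    lie f theta (phi s)) _ 0 T T0).
  - move=> s; apply: (@continuous_comp _ _ _ phi theta); first exact: cphi.
    exact: C1_continuous.
  - by rewrite phi0.
  - by move=> s sT; apply: is_derive_lie => //; exact: dphi.
  move=> s sT hs; have [/=|//] := cov _ (Vle s sT).
  by rewrite leNgt hs.
have flow_f K (F : 'rV[R]_n -> 'rV[R]_n) (phi : R -> 'rV[R]_n) :
    (forall x, K x -> F x = f x) ->
    (forall t, is_derive t (1 : R) phi (F (phi t))) ->
    (forall t : R, 0 <= t -> K (phi t)) ->
    forall t : R, 0 <= t -> is_derive t (1 : R) phi (f (phi t)).
  by move=> FK dphi phiK t t0; rewrite -FK//; exact: phiK.
have flow_unique x0 (phi : R -> 'rV[R]_n) : phi 0 = x0 ->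
    (forall t : R, 0 <= t -> is_derive t (1 : R) phi (f (phi t))) ->
    is_unique_solution f `[0, +oo[%classic x0 phi.
  move=> phi0 dphi; apply: solution_is_unique => //.
  by apply: is_derive_solution => // t /=; rewrite in_itv/= andbT; exact: dphi.
split.
- move=> x0; have [K [F [L [phi [cK [L0 FL FK [phi0 dphi] phiK]]]]]] := flow x0.
  exists phi; first exact: flow_unique phi0 (flow_f K F phi FK dphi phiK).
  have [M [Mr hM]] := compact_bounded cK.
  exists M; split=> // N MN t /=; rewrite in_itv/= andbT => t0.
  exact: hM (phiK t t0).
- move=> p /inS Vp; have [K [F [L [phi [cK [L0 FL FK [phi0 dphi] phiK]]]]]] := flow p.
  have dphif := flow_f K F phi FK dphi phiK.
  exists phi; first exact: flow_unique phi0 dphif.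
  move=> t t0; apply/inS/eqP; rewrite eq_le V_ge0 andbT -Vp -phi0.
  apply: (lyapunov_nincr V_C1 V_decr t0) => u /andP[u0 _]; exact: dphif.
- move=> x0 x ux; have [K [F [L [phi [cK [L0 FL FK [phi0 dphi] phiK]]]]]] := flow x0.
  have dphif := flow_f K F phi FK dphi phiK.
  have sphi := (flow_unique x0 phi phi0 dphif).1.
  (* The values of [x] at negative times are arbitrary, so [phi] replaces it: the limit set is
     unchanged and [phi] is continuous everywhere. *)
  have xphi (t : R) : 0 <= t -> x t = phi t.
    move=> t0; apply/esym; apply: (ux.2 `[0, +oo[%classic) => //=.
    + exact: interval_is_interval.
    + by rewrite in_itv/= lexx.
    + by rewrite in_itv/= t0.
  rewrite (omega_limit_eq xphi).
  have phiK_near : \forall t \near +oo, K (phi t).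
    by apply: filterS (nbhs_pinfty_ge (num_real 0)) => t; exact: phiK.
  split.
  + exact: (omega_limit_nonempty cK phiK_near).
  + exact: (omega_limit_compact cK phiK_near).
  + apply: (omega_limit_connected cK phiK_near) => t.
    exact: (is_derive_continuous (dphi t)).
  + move=> p wp; have [psi [psi0 dpsi wpsi]] :=
      omega_limit_entire_solution cK L0 FL FK dphi phiK wp.
    exists psi => //; apply: solution_is_unique => //.
    by apply: is_derive_solution => // t _; exact: dpsi.
  + move=> p wp; split.
      exact: (omega_limit_V V_C1 V_decr SV cK L0 FL FK dphi phiK wp).
    exact: (omega_limit_theta f_lip V_C1 theta_C1 V_decr theta_decr V_ge0 SV
      growth cK L0 FL FK dphi phiK wp).
move=> xs /inS Vxs eqxs [del del0 [hmin hset]].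
(* Used with [r = eps] for stability and [r = del] for attraction. The minimum with [del] keeps the
   sup-norm ball of radius [e] where [theta] has its strict minimum on [S]. *)
have stable (r : R) : 0 < r -> exists2 e : R, 0 < e &
    (forall x, `|x - xs| <= e -> enorm (x - xs) < r) /\
    exists2 d : R, 0 < d & forall x0, enorm (x0 - xs) < d ->
      forall phi : R -> 'rV[R]_n, phi 0 = x0 -> continuous phi ->
      (forall t : R, 0 <= t -> is_derive t (1 : R) phi (f (phi t))) ->
      forall t : R, 0 <= t -> `|phi t - xs| < e.
  move=> r0; have m0 : 0 < Num.min r del by rewrite lt_min r0 del0.
  have /nbhs_ballP[e2 /= e20 he] := near_enorm_lt xs m0.
  have e0 : 0 < e2 / 2 by rewrite divr_gt0.
  have hle x : `|x - xs| <= e2 / 2 -> enorm (x - xs) < Num.min r del.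
    move=> xe; apply: he; rewrite -ball_normE /= distrC (le_lt_trans xe)//; lra.
  exists (e2 / 2) => //; split.
    by move=> x /hle; rewrite lt_min => /andP[].
  have hm x : V x = 0 -> x <> xs -> `|x - xs| <= e2 / 2 -> theta xs < theta x.
    move=> Vx xxs /hle; rewrite lt_min => /andP[_ xdel].
    by apply: hmin => //; apply/inS.
  have /nbhs_ballP[d /= d0 hd] := stability_nbhd f_lip V_C1 theta_C1 V_decr
    theta_decr V_ge0 SV growth e0 Vxs hm.
  exists d => // x0 x0d; apply: hd; rewrite -ball_normE /= distrC.
  exact: le_lt_trans (norm_le_enorm _) x0d.
split=> //.
- move=> eps eps0; have [e e0 [he [d d0 hd]]] := stable eps eps0.
  exists d => // x0 x0d; have [K [F [L [phi [cK [L0 FL FK [phi0 dphi] phiK]]]]]] :=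
    flow x0.
  have dphif := flow_f K F phi FK dphi phiK.
  have cphi : continuous phi by move=> t; exact: (is_derive_continuous (dphi t)).
  exists phi; first exact: flow_unique phi0 dphif.
  by move=> t t0; apply: he; apply/ltW; exact: (hd x0 x0d phi phi0 cphi dphif t t0).
have [e e0 [he [d d0 hd]]] := stable del del0.
exists d => // x0 x0d; have [K [F [L [phi [cK [L0 FL FK [phi0 dphi] phiK]]]]]] :=
  flow x0.
have dphif := flow_f K F phi FK dphi phiK.
have cphi : continuous phi by move=> t; exact: (is_derive_continuous (dphi t)).
exists phi; first exact: flow_unique phi0 dphif.
pose B := [set x : 'rV[R]_n | `|x - xs| <= e].
have cB : compact B := @closed_ball_rV_compact _ _ xs e.
have phiB : \forall t \near +oo, B (phi t).
  apply: filterS (nbhs_pinfty_ge (num_real 0)) => t t0.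
  exact/ltW/(hd x0 x0d phi phi0 cphi dphif t t0).
(* Two compact sets are at work: [K] gives the vanishing of [V] and [lie f theta] on the limit set,
   and [B] places it in the neighbourhood where [xs] is the only such point. *)
have wxs p : omega_limit phi p -> p = xs.
  move=> wp; have Bp := omega_limit_sub cB phiB wp.
  have : [set x | [/\ S x, lie f theta x = 0 & enorm (x - xs) < del]] p.
    split; last exact: he.
      apply/inS.
      exact: (omega_limit_V V_C1 V_decr SV cK L0 FL FK dphi phiK wp).
    exact: (omega_limit_theta f_lip V_C1 theta_C1 V_decr theta_decr V_ge0 SV
      growth cK L0 FL FK dphi phiK wp).
  by rewrite hset.
apply/cvgrPdist_lt => r r0.
have wU : omega_limit phi `<=` [set x | `|xs - x| < r]°.
  by move=> p /wxs ->; exact: near_norm_lt.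
have att := omega_limit_attracts cB phiB (open_interior _) wU.
by apply: filterS att => t; exact: interior_subset.
Qed.
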